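(* Let $m\geq 2$, $n\geq 3$, $b\geq 2$ be integers, let $t=2m+b-n$, and let $\mathcal{T}(n,m,b)$ be the class of trees with $n$ vertices, matching number $m$ and exactly $b$ leaves. If $T\in\mathcal{T}(n,m,b)$, then $1\le t\le\min\{b,m\}$. Moreover, a tree $T$ has the Faber–Krahn property in the class $\mathcal{T}(n,m,b)$ (i.e. $T\in\mathcal{T}(n,m,b)$ and $\lambda_1(T)\le\lambda_1(T')$ for all $T'\in\mathcal{T}(n,m,b)$) if and only if $T\in\mathcal{T}(n,m,b)$ and one of the following holds. (1) $t=1$, and $T$ is isomorphic to $T(2m-3,\,2,\,b)$. (2) $t\ge 2$, and (a) if $t<m$, then $T$ is isomorphic to $T(2m-2t,\,t,\,b)$; (b) if $t=m=b$, then $T$ can be any tree such that each interior vertex is adjacent to exactly one leaf; (c) if $t=m<b$, then $T$ is isomorphic to $T(0,\,t,\,b)$.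
   Context: All graphs are finite, simple and undirected. For a tree $T=(V,E)$ with at least $3$ vertices, the boundary $B$ is the set of leaves (vertices of degree one) and $\Omega=V\setminus B$ is the interior (nonempty); elements of $\Omega$ are called interior vertices. The Dirichlet eigenvalue problem on $T$ is $-\Delta f(x)=\lambda f(x)$ for $x\in\Omega$, $f(x)=0$ for $x\in B$, where $\Delta f(x)=\sum_{y\sim x}(f(y)-f(x))$. Its smallest eigenvalue is $\lambda_1(T)=\min_{0\ne f\in\mathbb{R}^\Omega} R_T(f)$, where $R_T(f)=\frac{\sum_{xy\in E}(\widehat f(x)-\widehat f(y))^2}{\sum_{x\in\Omega}f(x)^2}$ and $\widehat f$ is the extension of $f$ to $V$ by $0$ on $B$ (each edge is counted once). The matching number of a graph is the maximum number of pairwise disjoint edges in it. A tree $T$ has the Faber–Krahn property in a class $\mathcal{C}$ if $T\in\mathcal{C}$ and $T$ has minimal first Dirichlet eigenvalue among all trees in $\mathcal{C}$. For integers $p\ge 0$ and $b\ge q\ge 2$, the tree $T(p,q,b)$ is obtained from a path $u_1\sim u_2\sim\cdots\sim u_{p+q}$ with $p+q$ vertices by attaching one new pendant vertex to each of $u_1,u_{p+2},u_{p+3},\ldots,u_{p+q-1}$ (for $q=2$: only to $u_1$), and attaching $b+1-q$ new pendant vertices to $u_{p+q}$. It has $p+q+b$ vertices, of which $b$ are leaves. *)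

(* Defs.v *)
From HB Require Import structures.
From mathcomp Require topology normedtype derive.
From mathcomp Require Import reals.
From mathcomp Require Import all_boot all_order all_algebra.
From mathcomp Require ring.

Set Implicit Arguments.
Unset Strict Implicit.
Unset Printing Implicit Defensive.

Import Order.TTheory GRing.Theory Num.Theory.
Local Open Scope ring_scope.

Record sgraph := SGraph {
  vertex :> finType;
  adj : rel vertex;
  adj_sym : symmetric adj;
  adj_irrefl : irreflexive adj
}.

Definition isomorphic (G H : sgraph) : Prop :=
  exists2 f : G -> H, bijective f & forall x y, adj (f x) (f y) = adj x y.

(* An edge traversed back and forth is a [ucycle] of size 2, so the genuine
   graph cycles are the ones with at least 3 vertices. *)
Definition acyclic (G : sgraph) : Prop :=
  forall c : seq G, ucycle (@adj G) c -> (size c < 3)%N.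

Definition is_tree (G : sgraph) : Prop :=
  [/\ (0 < #|G|)%N, forall x y : G, connect (@adj G) x y & acyclic G].

Definition degree (G : sgraph) (x : G) : nat := #|[set y | adj x y]|.

Definition leaves (G : sgraph) : {set G} := [set x | degree x == 1%N].

Definition interior_vertices (G : sgraph) : {set G} := ~: leaves G.

Definition edges (G : sgraph) : {set {set G}} :=
  [set [set x; y] | x in G, y in [set z | adj x z]].

Definition is_matching (G : sgraph) (M : {set {set G}}) : bool :=
  (M \subset edges G) && trivIset M.

Definition matching_number (G : sgraph) : nat :=
  \max_(M : {set {set G}} | is_matching M) #|M|.

Section Dirichlet.
Variables (R : realType) (G : sgraph).
Implicit Types f h : G -> R.

Definition laplacian f (x : G) : R := \sum_(y | adj x y) (f y - f x).

(* A function on the interior is represented by its extension by 0. *)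
Definition dirichlet_fun f : Prop := forall x, x \in leaves G -> f x = 0.

Definition dirichlet_eigenvalue (lam : R) : Prop :=
  exists f, [/\ exists x, f x != 0, dirichlet_fun f &
    forall x, x \in interior_vertices G -> - laplacian f x = lam * f x].

(* The infimum is a minimum as soon as the interior is nonempty, and it is
   also the minimum of the Rayleigh quotient: see [lambda1P]. *)
Definition lambda1 : R := inf dirichlet_eigenvalue.

(* Summing over ordered adjacent pairs counts each edge twice. *)
Definition rayleigh f : R :=
  (2^-1 * \sum_x \sum_(y | adj x y) (f x - f y) ^+ 2) /
  \sum_(x in interior_vertices G) f x ^+ 2.

Section Lambda1.
Import ring.

Let energy f h : R := \sum_x \sum_(y | adj x y) (f x - f y) * (h x - h y).
Let dot f h : R := \sum_x f x * h x.

Lemma green f h : energy f h = 2 * \sum_x h x * - laplacian f x.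
Proof.
have lapE x : h x * - laplacian f x = \sum_(y | adj x y) h x * (f x - f y).
  rewrite /laplacian -sumrN mulr_sumr; apply: eq_bigr => y _.
  by rewrite opprB.
under [in RHS]eq_bigr => x _ do rewrite lapE.
rewrite mulr2n mulrDl !mul1r.
rewrite [X in _ + X](exchange_big_dep xpredT) //= -big_split /=.
apply: eq_bigr => x _.
rewrite [X in _ + X](eq_bigl (fun y => adj x y)) => [|y]; last exact: adj_sym.
rewrite -big_split /=; apply: eq_bigr => y _; ring.
Qed.

Lemma dot_interior f : dirichlet_fun f ->
  dot f f = \sum_(x in interior_vertices G) f x ^+ 2.
Proof.
move=> f0; rewrite /dot (bigID [in interior_vertices G]) /= [X in _ + X]big1 ?addr0 //.
by move=> x; rewrite !inE negbK => xB; rewrite f0 ?mulr0 // inE.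
Qed.

Lemma dot_gt0 f x : f x != 0 -> 0 < dot f f.
Proof.
move=> fx; rewrite /dot (bigD1 x) //= ltr_pwDl //.
  by rewrite -expr2 exprn_even_gt0.
by apply: sumr_ge0 => y _; rewrite -expr2 sqr_ge0.
Qed.

Lemma energyZ a f h : energy (fun x => a * f x) (fun x => a * h x) =
  a ^+ 2 * energy f h.
Proof.
rewrite /energy mulr_sumr; apply: eq_bigr => x _; rewrite mulr_sumr.
by apply: eq_bigr => y _; ring.
Qed.

Lemma dotZ a f h : dot (fun x => a * f x) (fun x => a * h x) =
  a ^+ 2 * dot f h.
Proof. by rewrite /dot mulr_sumr; apply: eq_bigr => x _; ring. Qed.

Lemma energyDZ f h s :
  energy (fun x => f x + s * h x) (fun x => f x + s * h x) =
  energy f f + 2 * s * energy f h + s ^+ 2 * energy h h.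
Proof.
rewrite /energy !mulr_sumr -!big_split; apply: eq_bigr => x _ /=.
by rewrite !mulr_sumr -!big_split; apply: eq_bigr => y _ /=; ring.
Qed.

Lemma dotDZ f h s :
  dot (fun x => f x + s * h x) (fun x => f x + s * h x) =
  dot f f + 2 * s * dot f h + s ^+ 2 * dot h h.
Proof.
by rewrite /dot !mulr_sumr -!big_split; apply: eq_bigr => x _ /=; ring.
Qed.

Import boolp classical_sets topology normedtype derive.
Import numFieldNormedType.Exports.
Import finset.

Let vfun (v : 'rV[R]_#|G|) : G -> R := fun x => v ord0 (enum_rank x).

Lemma continuous_vfun x : continuous (fun v => vfun v x).
Proof. exact: coord_continuous. Qed.

Lemma continuous_bigsum (I : finType) (P : pred I)
    (F : I -> 'rV[R]_#|G| -> R) :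
  (forall i, continuous (F i)) -> continuous (fun v => \sum_(i | P i) F i v).
Proof.
by move=> cF; apply: continuous_big => // xy; exact: add_continuous.
Qed.

Lemma continuous_energy : continuous (fun v => energy (vfun v) (vfun v)).
Proof.
apply: continuous_bigsum => x; apply: continuous_bigsum => y v.
by apply: (@continuousM R _ (fun w => vfun w x - vfun w y)
    (fun w => vfun w x - vfun w y)); apply: (@continuousB R R^o);
  exact: continuous_vfun.
Qed.

Lemma continuous_dot : continuous (fun v => dot (vfun v) (vfun v)).
Proof.
apply: continuous_bigsum => x v.
by apply: (@continuousM R _ (fun w => vfun w x) (fun w => vfun w x));
  exact: continuous_vfun.
Qed.

Let sphere : set 'rV[R]_#|G| :=
  [set v | dirichlet_fun (vfun v) /\ dot (vfun v) (vfun v) = 1].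

Lemma sphere_compact : compact sphere.
Proof.
apply: bounded_closed_compact.
  exists 1; split; first exact: num_real.
  move=> M M1 v [_ v1]; rewrite /Num.norm /= mx_normrE.
  apply/bigmax_leP; split=> [|[i j] _ /=].
    by rewrite ltW// (lt_trans ltr01).
  have [//|Mv] := leP `|v i j| M; exfalso.
  suff : 1 < dot (vfun v) (vfun v) by rewrite v1 ltxx.
  rewrite /dot (bigD1 (enum_val j)) //= ltr_wpDr //.
    by apply: sumr_ge0 => y _; rewrite -expr2 sqr_ge0.
  rewrite /vfun enum_valK -expr2 -real_normK ?num_real //.
  rewrite exprn_egt1 // -[ord0](ord1 i) (lt_trans M1) //.
rewrite (_ : sphere = (\bigcap_(x in [set x | x \in leaves G])
     (fun v => vfun v x) @^-1` [set 0]) `&`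
   (fun v => dot (vfun v) (vfun v)) @^-1` [set 1])%classic.
  apply: closedI.
    apply: closed_bigI => x _; apply: preimage_closed; last exact: closed_eq.
    by move=> v _; exact: continuous_vfun.
  apply: preimage_closed; last exact: closed_eq.
  by move=> v _; exact: continuous_dot.
by apply/seteqP; split => v [] v0 v1; split.
Qed.

Lemma dirichlet_min x0 : x0 \in interior_vertices G ->
  exists g c, [/\ exists x, g x != 0, dirichlet_fun g,
    energy g g = c * dot g g &
    forall f, dirichlet_fun f -> c * dot f f <= energy f f].
Proof.
move=> x0I.
have rowE f : vfun (\row_i f (enum_val i)) = f.
  by apply/funext => x; rewrite /vfun mxE enum_rankK.
have unitE f : dirichlet_fun f -> 0 < dot f f ->
    sphere (\row_i ((Num.sqrt (dot f f))^-1 * f (enum_val i))).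
  move=> f0 fgt; pose k x := (Num.sqrt (dot f f))^-1 * f x.
  split; rewrite (rowE k).
    by move=> x /f0; rewrite /k => ->; rewrite mulr0.
  by rewrite dotZ exprVn sqr_sqrtr ?ltW// mulVf ?gt_eqF.
have s0 : (sphere !=set0)%classic.
  exists (\row_i ((Num.sqrt (dot (fun x => (x == x0)%:R)
    (fun x => (x == x0)%:R)))^-1 * (enum_val i == x0)%:R)).
  apply: (unitE (fun x => (x == x0)%:R)).
    move=> x xB; case: eqP => // xx0; move: x0I.
    by rewrite -xx0 finset.in_setC xB.
  by apply: (@dot_gt0 _ x0); rewrite eqxx oner_eq0.
have [v vs vmin] := EVT_min_rV s0 sphere_compact
  (continuous_subspaceT continuous_energy).
rewrite inE in vs; case: vs => v0 v1.
exists (vfun v), (energy (vfun v) (vfun v)); split => //.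
- apply: contrapT => /forallNP vz; suff : dot (vfun v) (vfun v) = 0.
    by rewrite v1 => /eqP; rewrite oner_eq0.
  rewrite /dot big1 // => x _; have /negP := vz x.
  by rewrite negbK => /eqP ->; rewrite mulr0.
- by rewrite v1 mulr1.
move=> f f0; have [[x fx]|fz] := pselect (exists x, f x != 0).
  have fgt := dot_gt0 fx; have := vmin _ (mem_set (unitE f f0 fgt)).
  rewrite (rowE (fun x => _ * f x)) energyZ exprVn sqr_sqrtr ?(ltW fgt) //.
  by rewrite ler_pdivlMl // mulrC.
have -> : f = fun=> 0.
  apply/funext => x; apply/eqP; apply: contrapT => /negP fx.
  by apply: fz; exists x.
rewrite (_ : dot _ _ = 0) ?mulr0; last first.
  by rewrite /dot big1 // => x; rewrite mulr0.
by apply: sumr_ge0 => x _; apply: sumr_ge0 => y _; rewrite subrr mulr0.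
Qed.

Lemma lambda1P : interior_vertices G != finset.set0 ->
  [/\ dirichlet_eigenvalue lambda1,
      forall mu, dirichlet_eigenvalue mu -> lambda1 <= mu,
      exists f, [/\ exists x, f x != 0, dirichlet_fun f & rayleigh f = lambda1]
    & forall f, (exists x, f x != 0) -> dirichlet_fun f ->
        lambda1 <= rayleigh f].
Proof.
case/set0Pn => x0 /dirichlet_min [g [c [gN0 g0 gE gmin]]].
have rayE f : dirichlet_fun f -> rayleigh f = 2^-1 * energy f f / dot f f.
  by move=> f0; rewrite /rayleigh dot_interior //; congr (_ * _ / _).
have gBh h : dirichlet_fun h -> energy g h = c * dot g h.
  move=> h0; pose D := energy g h - c * dot g h.
  pose E := energy h h - c * dot h h.
  have E0 : 0 <= E by rewrite subr_ge0 gmin.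
  have quad s : 0 <= 2 * s * D + s ^+ 2 * E.
    have /gmin : dirichlet_fun (fun x => g x + s * h x).
      by move=> x xB; rewrite g0 // h0 // mulr0 addr0.
    rewrite energyDZ dotDZ gE -subr_ge0; congr (0 <= _).
    by rewrite /D /E; ring.
  have E1 : 0 < E + 1 by rewrite ltr_wpDl.
  have : 0 <= - (D ^+ 2 * (E + 2)).
    have -> : - (D ^+ 2 * (E + 2)) = (E + 1) ^+ 2 *
        (2 * (- D / (E + 1)) * D + (- D / (E + 1)) ^+ 2 * E).
      by field; rewrite gt_eqF.
    by rewrite mulr_ge0 // sqr_ge0.
  rewrite oppr_ge0 => DE; have : D ^+ 2 <= 0.
    by rewrite -(pmulr_lle0 _ (_ : 0 < E + 2)) ?ltr_wpDl // mulrC.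
  by rewrite real_exprn_even_le0 ?num_real //= subr_eq0 => /eqP.
have geig : dirichlet_eigenvalue (2^-1 * c).
  exists g; split=> // x xI; have x0E : dirichlet_fun (fun y => (y == x)%:R).
    move=> y yB; case: eqP => // yx; move: xI.
    by rewrite -yx finset.in_setC yB.
  have := gBh _ x0E; rewrite green /dot (bigD1 x) //= [in RHS](bigD1 x) //=.
  rewrite eqxx mulr1 mul1r !big1 ?addr0 => [E|y /negPf ->|y /negPf ->];
    rewrite ?mul0r ?mulr0 //.
  by rewrite -mulrA -E mulKf ?pnatr_eq0.
have eig_ge mu : dirichlet_eigenvalue mu -> 2^-1 * c <= mu.
  move=> [f [[x fx] f0 fE]]; have fgt := dot_gt0 fx.
  rewrite -(ler_pM2r fgt) -mulrA.
  apply: le_trans (ler_wpM2l _ (gmin f f0)) _; first by rewrite invr_ge0 ler0n.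
  rewrite green mulKf ?pnatr_eq0 //.
  rewrite /dot mulr_sumr ler_sum // => y _.
  have [yB|yI] := boolP (y \in leaves G); first by rewrite f0 // !mul0r mulr0.
  by rewrite fE ?finset.in_setC // mulrCA.
have lamE : lambda1 = 2^-1 * c.
  apply/eqP; rewrite eq_le; apply/andP; split.
    by apply: ge_inf => //; exists (2^-1 * c) => mu; exact: eig_ge.
  by apply: lb_le_inf => [|mu]; [exists (2^-1 * c)|exact: eig_ge].
rewrite lamE; split=> //.
  exists g; split=> //; rewrite rayE // gE; case: gN0 => x /dot_gt0 gx.
  by rewrite mulrA mulfK // gt_eqF.
move=> f [x fx] f0; rewrite rayE // ler_pdivlMr ?(dot_gt0 fx) //.
by rewrite -mulrA ler_wpM2l ?invr_ge0 ?ler0n // gmin.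
Qed.

End Lambda1.
End Dirichlet.

Section PathTree.
Variables p q b : nat.

(* The path vertex u_(i+1) is [inl i] and the pendant vertices are the
   [inr k]; [pendant_at k] is the 0-based index i of the path vertex to which
   [inr k] is attached. For k = 0 it is u_1, for k = 1, ..., q - 2 it is
   u_(p+1+k), and the remaining b + 1 - q pendant vertices hang at u_(p+q).
   The parameters are meant to satisfy 2 <= q <= b. *)
Definition pendant_at (k : nat) : nat :=
  if k == 0 then 0 else if (k < q.-1)%N then (p + k)%N else (p + q).-1.

Definition path_tree_adj (u v : 'I_(p + q) + 'I_b) : bool :=
  match u, v with
  | inl i, inl j => (j == i.+1 :> nat) || (i == j.+1 :> nat)
  | inl i, inr k | inr k, inl i => i == pendant_at k :> nat
  | inr _, inr _ => false
  end.

Lemma path_tree_adj_sym : symmetric path_tree_adj.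
Proof. by move=> [i|k] [j|l] //=; rewrite orbC. Qed.

Lemma path_tree_adj_irrefl : irreflexive path_tree_adj.
Proof. by move=> [i|k] //=; rewrite orbb ltn_eqF. Qed.

Definition path_tree : sgraph :=
  SGraph path_tree_adj_sym path_tree_adj_irrefl.

End PathTree.

Definition tree_class (n m b : nat) (G : sgraph) : Prop :=
  [/\ is_tree G, #|G| = n, matching_number G = m & #|leaves G| = b].

Definition faber_krahn (R : realType) (C : sgraph -> Prop) (T : sgraph) :
    Prop :=
  C T /\ forall T', C T' -> lambda1 R T <= lambda1 R T'.

(* Main.v *)
Require Import Defs.
From mathcomp Require Import all_boot all_order all_algebra reals.
From mathcomp Require Import zify ring lra.

(* Rearrangement. Write a nonnegative function on the k interior vertices of a
   tree as a sequence 0 = a_0 <= a_1 <= ... <= a_k, the leaves having rank 0.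
   Expanding each a_y - a_x as a sum of increments l_i = a_(i+1) - a_i, the
   energy becomes the sum over i, j of c(i, j) l_i l_j, where c(i, j) counts
   the edges that go from rank at most min(i, j) to rank above max(i, j). In a
   tree with b leaves and at least q support vertices, every c(i, j) is bounded
   below: a set of interior vertices cannot be cut off at a single edge or a
   single vertex, and at least q - j leaf edges end above rank j. The tree
   path_tree p q b, ranked as its first eigenfunction, meets all these bounds
   at once, hence it minimizes lambda_1 among the trees with p + q interior
   vertices, b leaves and at least q support vertices. A tree of the class has
   2m - t interior vertices, and a matching meets at most one leaf per support
   vertex, so it has at least t of the latter (and always at least 2).
   If lambda_1 is equal, the rearranged function is an eigenfunction of the path
   tree. The equations make its increments positive, so all cuts agree, and they
   determine the tree. The exceptions are b = 2, where the tree is a path, and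
   t = m = b, where lambda_1 = 1 for the whole class. *)

Set Implicit Arguments.
Unset Strict Implicit.
Unset Printing Implicit Defensive.

Import Order.TTheory GRing.Theory Num.Theory.

(** * Forests *)

Section Graphs.
Variable G : sgraph.
Implicit Types (x y z r : G) (U W : {set G}).

(** Of two neighbours of the end of the path, one is not the preceding vertex; if it lay earlier on
    the path, it would close a cycle of length at least 3. *)
Lemma acyclic_extend W x p : acyclic G -> path (@adj G) x p -> uniq (x :: p) ->
  p != [::] -> (1 < #|[set y in W | adj (last x p) y]|)%N ->
  exists y, [/\ y \in W, adj (last x p) y & y \notin x :: p].
Proof.
move=> acyc; elim/last_ind: p => // p u _;
  rewrite last_rcons => pth unq _ /card_gt1P.
have [->|p_n0 [y1 [y2 [Wy1 Wy2 y12]]]] := altP (p =P [::]).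
  case=> y1 [y2]; rewrite !inE => -[/andP[Wy1 a1] /andP[Wy2 a2] y12].
  have nu y : adj u y -> y != u by apply: contraL => /eqP->; rewrite adj_irrefl.
  have [yx|yx] := altP (y1 =P x).
    by exists y2; rewrite !inE negb_or nu // -yx eq_sym y12.
  by exists y1; rewrite !inE negb_or nu // yx.
have [y [Wy auy yz]] : exists y, [/\ y \in W, adj u y & y != last x p].
  move: Wy1 Wy2; rewrite !inE => /andP[Wy1 a1] /andP[Wy2 a2].
  have [yz|yz] := altP (y1 =P last x p).
    by exists y2; split=> //; rewrite -yz eq_sym.
  by exists y1.
exists y; split=> //; apply/negP => yp.
have yu : y != u by apply: contraL auy => /eqP->; rewrite adj_irrefl.
have {}yp : y \in x :: p.
  by move: yp; rewrite -rcons_cons mem_rcons inE (negPf yu).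
case/splitPr def_p: {1}_ / yp => [p1 p2].
have pE : x :: rcons p u = p1 ++ y :: rcons p2 u.
  by rewrite -rcons_cons def_p rcons_cat rcons_cons.
have p2_n0 : p2 != [::].
  apply: contra yz => /eqP p2E; move: (congr1 (last x) def_p) => /=.
  by rewrite p2E last_cat /= => ->.
have : ucycle (@adj G) (y :: rcons p2 u).
  rewrite /ucycle /ucycleb; apply/andP; split; last first.
    by move: unq; rewrite pE cat_uniq => /and3P[].
  rewrite /cycle rcons_path last_rcons auy andbT.
  move: pth; case: p1 pE {def_p} => [|w p1] [-> ->] //.
  by rewrite cat_path => /andP[_] /= /andP[_].
by move/acyc; case: (p2) p2_n0 => // ? ? _; rewrite /= size_rcons.
Qed.

(** Otherwise a simple path inside [W] could be prolonged by [acyclic_extend] beyond [#|G|]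
    vertices. *)
Lemma acyclic_peel W r : acyclic G -> (1 < #|W|)%N ->
  exists x, [/\ x \in W, x != r & (#|[set y in W | adj x y]| <= (x != r))%N].
Proof.
move=> acyc W1.
case: (pickP [pred x | [&& x \in W, x != r &
    #|[set y in W | adj x y]| <= (x != r)]%N]) => [x /and3P[? ? ?]|noP].
  by exists x.
have {}noP x : x \in W -> x != r -> (1 < #|[set y in W | adj x y]|)%N.
  by move=> Wx xr; have /negbT := noP x; rewrite /= Wx xr /= -ltnNge.
(* The path starts at [s], the only vertex that may have exactly one neighbour in [W]: it is [r] if
   [r] has a neighbour there. *)
have [s [Ws s_nb sP]] : exists s, [/\ s \in W,
    (0 < #|[set y in W | adj s y]|)%N &
    forall x, x \in W -> x != s -> (0 < #|[set y in W | adj x y]|)%N ->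
      (1 < #|[set y in W | adj x y]|)%N].
  have [/andP[rW r_nb]|] := boolP ((r \in W) && (0 < #|[set y in W | adj r
    y]|)%N).
    by exists r; split=> // x Wx xr _; apply: noP.
  rewrite negb_and => nr.
  have [x Wx xr] : exists2 x, x \in W & x != r.
    case/card_gt1P: W1 => x [y [Wx Wy xy]].
    by have [E|] := altP (x =P r); [exists y; rewrite // -E eq_sym|exists x].
  exists x; split=> //; first exact: ltnW (noP _ Wx xr).
  move=> y Wy _ y0; apply: noP => //; apply: contraTneq y0 => yr.
  by move: nr; rewrite -yr Wy.
have grow n : exists p, [/\ size p = n.+1, path (@adj G) s p, uniq (s :: p)
    & {subset p <= W}].
  elim: n => [|n [p [sz pth unq pW]]].
    case/card_gt0P: s_nb => y; rewrite !inE => /andP[Wy asy].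
    exists [:: y]; split=> //=; rewrite ?asy // ?inE ?andbT.
      by apply: contraTneq asy => ->; rewrite adj_irrefl.
    by move=> z; rewrite inE => /eqP->.
  have p_n0 : p != [::] by case: p sz {pth unq pW}.
  have lW : last s p \in W.
    by apply: pW; case/lastP: p p_n0 {sz pth unq} => // p z _;
      rewrite last_rcons mem_rcons mem_head.
  have ls : last s p != s.
    case/lastP: p p_n0 unq {sz pth pW lW} => // p z _;
      rewrite last_rcons -rcons_cons.
    rewrite rcons_uniq inE negb_or => /andP[/andP[]//].
  have lnb : (0 < #|[set y in W | adj (last s p) y]|)%N.
    case/lastP: p p_n0 unq pth pW {sz lW ls} => // p z _ _.
    rewrite last_rcons rcons_path adj_sym => /andP[_ azl] pW.
    apply/card_gt0P; exists (last s p); rewrite inE azl andbT.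
    case/lastP: p {azl} pW => [//|p w] pW; apply: pW.
    by rewrite last_rcons !(mem_rcons, inE) eqxx orbT.
  have [y [Wy aly yp]] := acyclic_extend acyc pth unq p_n0 (sP _ lW ls lnb).
  exists (rcons p y); rewrite size_rcons sz rcons_path pth aly -rcons_cons.
  rewrite rcons_uniq yp unq; split=> // z; rewrite mem_rcons inE.
  by case/predU1P => [->//|/pW].
have [p [sz _ /card_uniqP + _]] := grow #|G|.
by rewrite /= sz => E; have := max_card (mem (s :: p)); rewrite E; lia.
Qed.

End Graphs.

(** An elimination order of a forest: the only neighbour of [x] that may fail to be below [x] is its
    parent, and the root [r] has none. *)
Definition rooted_order (G : sgraph) (r : G) (o : G -> nat) : Prop :=
  forall x, (#|[set y | adj x y & (o x <= o y)%N]| <= (x != r))%N.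

Section RootedOrder.
Variables (G : sgraph) (r : G).
Implicit Types (x y z : G).

Lemma acyclic_order : acyclic G -> exists o, rooted_order r o.
Proof.
move=> acyc.
have [o oP] : exists o : G -> nat, forall x, x \in [set: G] ->
    (#|[set y in [set: G] | adj x y & (o x <= o y)%N]| <= (x != r))%N.
  have: r \in [set: G] by [].
  move: [set: G] => W rW; have [n] := ubnP #|W|; elim: n W rW => // n IHn W rW.
  rewrite ltnS => Wn.
  have [W1|W1] := leqP #|W| 1.
    exists (fun=> 0%N) => x Wx; apply: leq_trans (leq0n _).
    rewrite leqn0 cards_eq0; apply/eqP/setP => y; rewrite !inE;
      apply/negP => /and3P[Wy axy _].
    by move/card_le1_eqP: W1 axy => /(_ _ _ Wx Wy) ->; rewrite adj_irrefl.
  have [x [Wx xr deg]] := acyclic_peel r acyc W1.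
  have [||o oP] := IHn (W :\ x).
  - by rewrite !inE eq_sym xr.
  - by rewrite (cardsD1 x) Wx in Wn.
  (* The peeled vertex is put below all others: it adds no upper neighbour to them, and [deg] bounds
     its own. *)
  exists (fun y => if y == x then 0%N else (o y).+1) => y Wy.
  have [->|yx] := eqVneq y x.
    apply: leq_trans (deg); apply: subset_leq_card.
    by apply/subsetP => z; rewrite !inE => /and3P[-> ->].
  apply: leq_trans (oP y _); last by rewrite !inE yx.
  apply: subset_leq_card; apply/subsetP => z; rewrite !inE.
  by case: (eqVneq z x) => //= _; rewrite !andbF.
by exists o => x; apply: leq_trans (oP x _) => //; apply: subset_leq_card;
  apply/subsetP => y; rewrite !inE.
Qed.

Variable o : G -> nat.
Hypothesis oP : rooted_order r o.

Lemma order_upper_uniq x y z : adj x y -> adj x z ->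
  (o x <= o y)%N -> (o x <= o z)%N -> y = z.
Proof.
move=> axy axz oxy oxz.
have /card_le1_eqP H : (#|[set y | adj x y & (o x <= o y)%N]| <= 1)%N.
  exact: leq_trans (oP x) (leq_b1 _).
by apply: H; rewrite inE ?axy ?axz.
Qed.

Lemma order_root x : adj r x -> (o x < o r)%N.
Proof.
move=> arx; rewrite ltnNge; apply/negP => orx.
have := oP r; rewrite eqxx leqn0 cards_eq0 => /eqP/setP/(_ x).
by rewrite !inE arx orx.
Qed.

Lemma order_lower x : ((x != r) < degree x)%N -> exists2 y, adj x y & (o y < o
  x)%N.
Proof.
move=> dx; case: (pickP [pred y | adj x y && (o y < o x)%N]) => [y /andP[]|no].
  by exists y.
suff : (degree x <= (x != r))%N by rewrite leqNgt dx.
apply: leq_trans (oP x); apply: subset_leq_card; apply/subsetP => y.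
by rewrite !inE => axy; have /negbT := no y; rewrite /= axy /= -leqNgt.
Qed.

End RootedOrder.

(* Root the forest at [x]: the lowest vertex of [U] has a neighbour below it,
   and the root is below no vertex. *)
Lemma two_exits (G : sgraph) (U : {set G}) (x : G) : acyclic G -> U != set0 ->
  (forall u, u \in U -> (1 < degree u)%N) ->
  exists u y, [/\ u \in U, y \notin U, y != x & adj u y].
Proof.
move=> acyc /set0Pn[u0 u0U] degU.
have [o oP] := acyclic_order x acyc.
case: (arg_minnP o u0U) => u uU umin.
have [y auy ouy] := order_lower oP (leq_ltn_trans (leq_b1 _) (degU u uU)).
exists u, y; split=> //.
  by apply/negP => /umin; rewrite leqNgt ouy.
apply: contraTneq ouy => yx; rewrite -leqNgt; move: auy.
by rewrite yx adj_sym => /(order_root oP)/ltnW.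
Qed.

(** The highest vertex of a cycle would have two distinct neighbours that are not above it. *)
Lemma order_acyclic (G : sgraph) (o : G -> nat) :
  (forall x y z, adj x y -> adj x z -> (o y <= o x)%N -> (o z <= o x)%N ->
    y = z) -> acyclic G.
Proof.
move=> oP c uc; rewrite leqNgt; apply/negP => c3.
have [x0 x0c] : exists x, x \in c by case: (c) c3 => // x ? _; exists x;
  rewrite mem_head.
case: (arg_maxnP o x0c) => x xc xmax.
have [i c' c'E] := rot_to xc.
move: uc; rewrite -(rot_ucycle i) c'E => /andP[].
have : (2 < size (x :: c'))%N by rewrite -c'E size_rot.
case: c' c'E => [|y [|z s]] // c'E _.
rewrite /= rcons_path /= => /and3P[axy _ /andP[_ alx]] /and3P[xn yn _].
have mem w : w \in [:: x, y, z & s] -> (o w <= o x)%N.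
  by rewrite -c'E mem_rot => /xmax.
have yl : y = last z s.
  apply: (oP x) => //; first by rewrite adj_sym.
    by apply: mem; rewrite !inE eqxx orbT.
  by apply: mem; do 2 rewrite inE; rewrite mem_last !orbT.
by move: yn; rewrite yl mem_last.
Qed.

Section Trees.
Variable G : sgraph.
Hypotheses (treeG : is_tree G) (G_gt2 : (2 < #|G|)%N).
Implicit Types (x y z : G) (X : {set G}).

Let acycG : acyclic G. Proof. by case: treeG. Qed.

Lemma tree_cross X : X != set0 -> X != setT ->
  exists x y, [/\ x \in X, y \notin X & adj x y].
Proof.
move=> /set0Pn [x xX] XnT.
case: (pickP [pred e : G * G | [&& e.1 \in X, e.2 \notin X & adj e.1 e.2]]).
  by case=> u v /and3P[]; exists u, v.
move=> noE; case/eqP: XnT; apply/setP => y; rewrite inE.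
have clX : closed (@adj G) (mem X).
  apply: intro_closed; first exact: sym_connect_sym (@adj_sym G).
  move=> u v auv uX; have := noE (u, v); rewrite /= uX auv andbT.
  by move/negbFE.
by case: treeG => _ /(_ x y) /(closed_connect clX) <-.
Qed.

Lemma degree_gt0 x : (0 < degree x)%N.
Proof.
have [||u [y [/set1P-> _ axy]]] := @tree_cross [set x].
- by apply/set0Pn; exists x; rewrite inE.
- apply: contraTneq G_gt2 => E; rewrite -leqNgt -cardsT -E cards1 //.
by apply/card_gt0P; exists y; rewrite inE.
Qed.

Lemma interior_degree x : (x \in interior_vertices G) = (1 < degree x)%N.
Proof. by rewrite !inE; have := degree_gt0 x; lia. Qed.

Lemma leaf_neighbour x : x \in leaves G -> exists2 y, adj x y &
  forall z, adj x z -> z = y.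
Proof.
rewrite inE => /cards1P [y xE]; exists y; first by have := set11 y;
  rewrite -xE inE.
by move=> z; have := in_set1 z y; rewrite -xE inE => -> /eqP.
Qed.

(** Two adjacent leaves would form a whole component. *)
Lemma leaf_adj_interior x y : x \in leaves G -> adj x y ->
  y \in interior_vertices G.
Proof.
move=> xL axy; rewrite inE; apply/negP => yL.
have [x' ayx' x'P] := leaf_neighbour yL;
  have [y' axy' y'P] := leaf_neighbour xL.
have [||u [v [uX vX auv]]] := @tree_cross [set x; y].
- by apply/set0Pn; exists x; rewrite !inE eqxx.
- apply: contraTneq G_gt2 => E; rewrite -leqNgt -cardsT -E cards2.
  by case: (x != y).
move: vX; case/set2P: uX auv => -> auv.
  by rewrite !inE (y'P _ auv) (y'P _ axy) eqxx orbT.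
by rewrite !inE (x'P _ auv) -(x'P x) ?eqxx // adj_sym.
Qed.

End Trees.

(** * Matchings *)

Definition support_vertices (G : sgraph) : {set G} :=
  [set x | [exists y in leaves G, adj x y]].

Section Matchings.
Variable G : sgraph.
Implicit Types (x y z : G) (e : {set G}) (M : {set {set G}}).

Lemma edgesP e : reflect (exists x y, adj x y /\ e = [set x;
  y]) (e \in edges G).
Proof.
apply: (iffP imset2P) => [[x y _]|[x [y [axy ->]]]].
  by rewrite inE => axy ->; exists x, y.
by exists x y; rewrite ?inE.
Qed.

Lemma card_edge e : e \in edges G -> #|e| = 2.
Proof.
case/edgesP => x [y [axy ->]]; rewrite cards2.
by case: eqP axy => // ->; rewrite adj_irrefl.
Qed.

Lemma leq_matching_number (I : finType) (u v : I -> G) :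
  (forall i, adj (u i) (v i)) ->
  (forall i j, i != j -> [/\ u i != u j, u i != v j & v i != v j]) ->
  (#|I| <= matching_number G)%N.
Proof.
move=> auv duv; pose E i := [set u i; v i].
have disE i j x : x \in E i -> x \in E j -> i = j.
  move=> xi xj; apply/eqP/negPn/negP => nij.
  have [uu uv vv] := duv _ _ nij; rewrite eq_sym in nij;
    have [_ vu _] := duv _ _ nij.
  case/set2P: xi xj => -> /set2P[] /eqP;
    rewrite ?(negPf uu) ?(negPf uv) ?(negPf vv) //.
  by rewrite eq_sym (negPf vu).
pose M := [set E i | i in I].
have injE : injective E.
  by move=> i j Eij; apply: (@disE i j (u i)); rewrite -?Eij !inE eqxx.
have <- : #|M| = #|I| by rewrite card_imset.
apply: (@leq_bigmax_cond _ (@is_matching G) (fun M => #|M|)).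
apply/andP; split.
  apply/subsetP => _ /imsetP[i _ ->]; apply/edgesP; by exists (u i), (v i).
apply/trivIsetP => _ _ /imsetP[i _ ->] /imsetP[j _ ->] nE.
apply/pred0P => x; apply/negP => /andP[/disE xi /xi ij].
by case/eqP: nE; rewrite ij.
Qed.

Lemma matching_numberP : exists M, [/\ M \subset edges G,
  forall e e' x, e \in M -> e' \in M -> x \in e -> x \in e' -> e = e',
  #|cover M| = 2 * #|M| & #|M| = matching_number G].
Proof.
have [|M /andP[ME trM] Mmax] := @eq_bigmax_cond _ (@is_matching G) (fun M =>
  #|M|).
  apply/card_gt0P; exists set0; apply/andP; split; first exact: sub0set.
  by apply/trivIsetP => e e'; rewrite inE.
exists M; split=> //.
- move=> e e' x eM e'M xe xe'; apply/eqP/negPn/negP => ne.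
  move/trivIsetP: trM => /(_ _ _ eM e'M ne) /pred0P/(_ x).
  by rewrite /= xe xe'.
- move: trM; rewrite /trivIset => /eqP <-.
  rewrite mulnC -sum_nat_const; apply: eq_bigr => e eM.
  by apply: card_edge; apply: (subsetP ME).
Qed.

Lemma card_interior : #|interior_vertices G| + #|leaves G| = #|G|.
Proof. by rewrite addnC cardsC. Qed.

(** Twice the matching number counts the vertices covered by a maximum matching. The covered leaves
    are matched to distinct support vertices, and the other covered vertices are interior. *)
Lemma matching_number_supports : (2 * matching_number G + #|leaves G| <=
  #|G| + #|support_vertices G|)%N.
Proof.
have [M [ME disM covM <-]] := matching_numberP; rewrite -covM.
suff LA : (#|cover M :&: leaves G| <= #|support_vertices G|)%N.
  rewrite -(cardsID (leaves G) (cover M)) -card_interior.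
  suff : (#|cover M :\: leaves G| <= #|interior_vertices G|)%N by lia.
  by apply: subset_leq_card; rewrite setDE subsetIr.
have ex x : exists y, (x \in cover M :&: leaves G) ==>
    (adj x y && ([set x; y] \in M)).
  rewrite inE; have [xL|] := boolP (x \in leaves G); last by rewrite andbF;
    exists x.
  rewrite andbT; case: bigcupP => [[e eM xe]|_]; last by exists x.
  have /edgesP[u [v [auv eE]]] := subsetP ME _ eM.
  move: xe; rewrite eE in eM *; case/set2P => ->; first by exists v;
    rewrite auv.
  by exists u; rewrite adj_sym auv setUC.
have [h hP] := fin_all_exists ex.
rewrite -(card_in_imset (f := h) (D := cover M :&: leaves G)).
  apply: subset_leq_card; apply/subsetP => _ /imsetP[x xML ->].
  move: (hP x); rewrite xML inE => /andP[axh _]; apply/existsP; exists x.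
  by move: xML; rewrite inE adj_sym axh => /andP[_ ->].
move=> x x' xML x'ML hE.
move: (hP x) (hP x'); rewrite xML x'ML -hE => /andP[axh eM] /andP[ax'h e'M].
have E := disM _ _ (h x) eM e'M (set22 _ _) (set22 _ _).
have := set21 x (h x); rewrite E => /set2P[//|xh].
by move: axh; rewrite -xh adj_irrefl.
Qed.

Hypotheses (treeG : is_tree G) (G_gt2 : (2 < #|G|)%N).

(** No edge joins two leaves, so disjoint edges have distinct interior ends. *)
Lemma matching_number_interior :
  (matching_number G <= #|interior_vertices G|)%N.
Proof.
have [M [ME disM _ <-]] := matching_numberP.
have ex e : exists x, (e \in M) ==> (x \in e) && (x \in interior_vertices G).
  have [/(subsetP ME)/edgesP[x [y [axy ->]]]|_] := boolP (e \in M); last first.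
    by case/card_gt0P: (ltnW (ltnW G_gt2)) => x _; exists x.
  have [xL|xI] := boolP (x \in leaves G).
    by exists y; rewrite (leaf_adj_interior treeG G_gt2 xL axy) !inE eqxx orbT.
  by exists x; rewrite set21 in_setC.
have [h hP] := fin_all_exists ex.
rewrite -(card_in_imset (f := h) (D := M)).
  apply: subset_leq_card; apply/subsetP => _ /imsetP[e eM ->].
  by move: (hP e); rewrite eM => /andP[].
move=> e e' eM e'M hE.
move: (hP e) (hP e'); rewrite eM e'M hE => /andP[he _] /andP[he' _].
exact: disM he he'.
Qed.

(* Every interior vertex, and the root [r], has a neighbour below it, and
   these are distinct: the forest is covered by descending paths, and we
   take every other edge of each of them, starting from the bottom. *)
Lemma matching_number_half r : r \in leaves G ->
  (#|interior_vertices G| < 2 * matching_number G)%N.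
Proof.
move=> rL; have [_ _ acyc] := treeG; have [o oP] := acyclic_order r acyc.
pose D := r |: interior_vertices G.
have cardD : #|D| = #|interior_vertices G|.+1 by rewrite cardsU1 in_setC rL.
have ex x : exists y, (x \in D) ==> (adj x y && (o y < o x)%N).
  have [xD|_] := boolP (x \in D); last by exists x.
  have [|y axy oyx] := order_lower oP (x := x); last by exists y; rewrite axy.
  case/setU1P: xD => [->|xI]; first by rewrite eqxx (degree_gt0 treeG G_gt2).
  apply: leq_ltn_trans (leq_b1 _) _; by rewrite -interior_degree.
have [c cP] := fin_all_exists ex.
have cD x : x \in D -> adj x (c x) /\ (o (c x) < o x)%N.
  by move=> xD; move: (cP x); rewrite xD => /andP.
have c_inj : {in D &, injective c}.
  move=> x y /cD[axc ocx] /cD[ayc ocy] E; rewrite -E in ayc ocy.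
  by apply: (order_upper_uniq oP (x := c x)); rewrite 1?adj_sym // ltnW.
(* For [x] in [D], the edge from [x] to [c x] is taken exactly when the one below it is not. The
   counter makes the recursion structural; by [parE] any value above [o x] gives the same result. *)
pose fix par n x {struct n} := if n is n'.+1 then (x \in D) && ~~ par n' (c x)
  else false.
have parE n m x : (o x < n)%N -> (o x < m)%N -> par n x = par m x.
  elim: n m x => // n IHn [//|m] x oxn oxm /=.
  have [xD|//] := boolP (x \in D); have [_ ocx] := cD _ xD.
  by congr (~~ _); apply: IHn; lia.
pose P := [set x | par (o x).+1 x].
have PD x : x \in P -> x \in D by rewrite inE /= => /andP[].
have DP x : x \in D -> (c x \in P) = (x \notin P).
  have inP y : (y \in P) = par (o y).+1 y by rewrite inE.
  have parS y n : par n.+1 y = (y \in D) && ~~ par n (c y) by [].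
  move=> xD; rewrite !inP [in RHS]parS xD negbK.
  by apply: parE => //; case: (cD _ xD).
rewrite -cardD;
  suff [DP2 Pm] : (#|D| <= 2 * #|P|)%N /\ (#|P| <= matching_number G)%N.
  by apply: leq_trans DP2 _; rewrite leq_pmul2l.
split.
  (* [c] maps [D :\: P] injectively into [P], so [P] is at least half of [D]. *)
  rewrite -(cardsID P D) mulSn mul1n leq_add //.
    by apply: subset_leq_card; rewrite subsetIr.
  rewrite -(card_in_imset (f := c) (D := D :\: P)).
    apply: subset_leq_card; apply/subsetP => _ /imsetP[x + ->].
    by rewrite inE => /andP[xP /DP ->].
  by move=> x y; rewrite !inE => /andP[_ xD] /andP[_ yD]; apply: c_inj;
    rewrite !inE.
rewrite -[#|P|]card_ord.
have iP (i : 'I_#|P|) : enum_val i \in P by exact: enum_valP.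
apply: (@leq_matching_number _ enum_val (c \o enum_val)) => [i|i j ij] /=.
  by case: (cD _ (PD _ (iP i))).
split; first by rewrite (inj_eq enum_val_inj).
  by apply: contraTneq (iP i) => ->; rewrite DP ?PD ?iP.
by apply: contraNneq ij => /c_inj/enum_val_inj-> //; exact/PD/iP.
Qed.

End Matchings.

(** * Edge cuts of a ranked tree *)

(* The interior vertices are numbered bijectively by 1, ..., k, and the leaves
   all have rank 0. *)
Definition ranking (G : sgraph) (k : nat) (r : G -> nat) : Prop :=
  [/\ forall x, (r x == 0%N) = (x \in leaves G),
      {in interior_vertices G &, injective r},
      forall x, (r x <= k)%N & #|interior_vertices G| = k].

Definition cut (G : sgraph) (r : G -> nat) (i j : nat) : nat :=
  #|[set e : G * G | [&& adj e.1 e.2, r e.1 <= i & j < r e.2]%N]|.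

(* The cuts of [path_tree p q b] for its ranking [path_rank] below. *)
Definition min_cut (q b i j : nat) : nat :=
  if i == j then if j == 0 then b else (maxn (q - j) 1).+1
  else if i.+1 == j then maxn (q - j) 1 else q - j.

Section Ranking.
Variables (G : sgraph) (k : nat) (r : G -> nat).
Hypothesis rk : ranking k r.
Implicit Types (x y z : G).

Lemma rank_eq0 x : (r x == 0) = (x \in leaves G).
Proof. by case: rk. Qed.

Lemma rank_gt0 x : (0 < r x) = (x \in interior_vertices G).
Proof. by rewrite lt0n rank_eq0 in_setC. Qed.

Lemma rank_le x : r x <= k.
Proof. by case: rk. Qed.

Lemma rank_inj x y : 0 < r x -> r x = r y -> x = y.
Proof.
move=> rx E; have ry := rx; rewrite E in ry.
by case: rk => _ + _ _; apply; rewrite -?rank_gt0.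
Qed.

Lemma rank_perm : perm_eq [seq r x | x <- enum (interior_vertices G)] (iota 1
  k).
Proof.
case: rk => _ r_inj r_le cardI.
have unq : uniq [seq r x | x <- enum (interior_vertices G)].
  by rewrite map_inj_in_uniq ?enum_uniq // => x y; rewrite !mem_enum;
    apply: r_inj.
apply: uniq_perm => //; first exact: iota_uniq.
have sub : {subset [seq r x | x <- enum (interior_vertices G)] <= iota 1 k}.
  move=> _ /mapP[x + ->]; rewrite mem_enum mem_iota -rank_gt0 => ->.
  by rewrite add1n ltnS r_le.
have [|_ E] := uniq_min_size unq sub; last exact: E.
by rewrite size_iota size_map -cardE cardI.
Qed.

Lemma rank_surj j : 0 < j <= k -> exists x, r x = j.
Proof.
move=> jk; have : j \in iota 1 k by rewrite mem_iota add1n ltnS.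
by rewrite -(perm_mem rank_perm) => /mapP[x _ ->]; exists x.
Qed.

Hypotheses (treeG : is_tree G) (G_gt2 : 2 < #|G|).

Let acycG : acyclic G. Proof. by case: treeG. Qed.

(** The free choice of [x] allows a prescribed lower end to be avoided: this yields a second exit,
    or an exit that misses the vertex of rank [j]. *)
Lemma rank_exits j x : j < k ->
  exists u y, [/\ j < r u, r y <= j, y != x & adj y u].
Proof.
move=> jk; have [v rv] := rank_surj (j := k) ltac:(lia).
have [||u [y []]] := @two_exits G [set u | j < r u] x acycG.
- by apply/set0Pn; exists v; rewrite inE rv.
- by move=> u; rewrite inE -interior_degree // -rank_gt0; lia.
by rewrite !inE -leqNgt adj_sym => *; exists u, y.
Qed.

Lemma interior_exit j : 0 < j < k ->
  exists x y, [/\ 0 < r x <= j, j < r y & adj x y].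
Proof.
move=> jk; have [v1 rv1] := rank_surj (j := 1) ltac:(lia).
have [vk rvk] := rank_surj (j := k) ltac:(lia).
(* The low interior vertices are taken together with the leaves hanging from them, so that an edge
   leaving [X] joins two interior vertices. *)
pose X := [set x | (0 < r x <= j)
  || ((r x == 0) && [forall y, adj x y ==> (r y <= j)])].
have [||x [y []]] := tree_cross treeG (X := X).
- by apply/set0Pn; exists v1; rewrite inE rv1; lia.
- apply/negP => /eqP/setP/(_ vk); rewrite !inE rvk; lia.
rewrite [x \in _]inE => /orP[rx|/andP[+ /forallP xX]] yX axy; last first.
  rewrite rank_eq0 => xL; case/negP: yX;
    rewrite inE rank_gt0 (leaf_adj_interior treeG G_gt2 xL axy).
  by have := xX y; rewrite axy /= => ->.
exists x, y; split=> //; rewrite ltnNge; apply: contra yX => ryj.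
rewrite inE ryj andbT lt0n; have [|//] := boolP (r y == 0).
rewrite rank_eq0 /= => yL.
have [z _ zP] := leaf_neighbour yL.
apply/forallP => w; apply/implyP => /zP ->.
by rewrite -(zP x) 1?adj_sym //; case/andP: rx.
Qed.

(** At most [j] support vertices have rank at most [j], since ranks are injective on the interior;
    each of the others has a leaf edge. *)
Lemma card_leaf_edges q j : q <= #|support_vertices G| ->
  q - j <= #|[set e : G * G | [&& adj e.1 e.2, r e.1 == 0 & j < r e.2]]|.
Proof.
move=> qA; set L := [set e | _].
have : #|[set y in support_vertices G | j < r y]| <= #|L|.
  apply: leq_trans (leq_imset_card snd _); apply: subset_leq_card.
  apply/subsetP => y; rewrite !inE => /andP[/existsP[x /andP[xL ayx]] ry].
  apply/imsetP; exists (x, y) => //;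
    rewrite inE /= rank_eq0 xL ry adj_sym ayx //.
apply: leq_trans; rewrite leq_subLR; apply: leq_trans qA _.
set A := support_vertices G; rewrite -(cardsID [set y | j < r y] A) addnC.
rewrite (_ : A :&: _ = [set y in A | j < r y]); last by apply/setP => y;
  rewrite !inE.
rewrite leq_add2r; set B := A :\: _.
have BI x : x \in B -> 0 < r x <= j.
  rewrite !inE -leqNgt => /andP[-> /existsP[y /andP[yL axy]]].
  by rewrite andbT rank_gt0 (leaf_adj_interior treeG G_gt2 yL) // adj_sym.
rewrite -[leqRHS](size_iota 1) cardE -(size_map r); apply: uniq_leq_size.
  rewrite map_inj_in_uniq ?enum_uniq // => x y; rewrite !mem_enum.
  by move=> /BI/andP[rx _] _; apply: rank_inj.
by move=> _ /mapP[x + ->]; rewrite mem_enum mem_iota add1n ltnS => /BI.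
Qed.

(** For [i = j > 0], the leaf edges come with one edge between interior vertices, and there are
    always two exits. For [i + 1 = j], one exit avoids the vertex of rank [j]. Otherwise only leaf
    edges are counted. *)
Lemma min_cut_le q b i j : #|leaves G| = b -> q <= #|support_vertices G| ->
  i <= j -> j < k -> min_cut q b i j <= cut r i j.
Proof.
move=> cardL qA; have leafE := card_leaf_edges _ qA.
set L := fun j => [set e : G * G | [&& adj e.1 e.2, r e.1 == 0 & j < r e.2]]
  in leafE.
have LC i' j' : q - j' <= cut r i' j'.
  apply: leq_trans (leafE j') _; apply: subset_leq_card; apply/subsetP => e.
  by rewrite !inE => /and3P[-> /eqP-> ->].
move=> ij jk; rewrite /min_cut; case: (eqVneq i j) => [->{i ij}|nij].
  have [->|j0] := eqVneq j 0.
    rewrite -cardL; apply: leq_trans (leq_imset_card fst _);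
      apply: subset_leq_card.
    apply/subsetP => x xL; have [y axy _] := leaf_neighbour xL.
    apply/imsetP; exists (x, y) => //; rewrite inE /= axy rank_gt0.
    by rewrite (leaf_adj_interior treeG G_gt2 xL axy) leqn0 rank_eq0 xL.
  pose C := [set e : G * G | [&& adj e.1 e.2, r e.1 <= j & j < r e.2]].
  rewrite -/(#|C|) -addn1 addn_maxl geq_max; apply/andP; split; last first.
    have [x _] := rank_surj (j := k) ltac:(lia).
    have [u [y [ju ryj _ ayu]]] := rank_exits x jk.
    have [v [z [jv rzj zy azv]]] := rank_exits y jk.
    have <- : #|[set (y, u); (z, v)]| = 1 + 1.
      by rewrite cards2 xpair_eqE negb_and eq_sym zy.
    by apply: subset_leq_card; apply/subsetP => _ /set2P[] ->; rewrite inE /=;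
      apply/and3P.
  have [x [y [/andP[rx rxj] jy axy]]] := interior_exit (j := j) ltac:(lia).
  apply: leq_trans (_ : #|(x, y) |: L j| <= _).
    by rewrite cardsU1 !inE /= eqn0Ngt rx andbF addnC leq_add2l leafE.
  apply: subset_leq_card; apply/subsetP => e /setU1P[->|]; rewrite !inE /=.
    by apply/and3P.
  by case/and3P => -> /eqP-> ->.
case: eqVneq => [ijE|_]; last exact: LC.
rewrite geq_max LC /=.
have [x rx] := rank_surj (j := j) ltac:(lia).
have [u [y [ju ryj yx ayu]]] := rank_exits x jk.
apply/card_gt0P; exists (y, u); rewrite inE /= ayu ju andbT.
have : r y != r x by apply: contra yx => /eqP E; apply/eqP/esym/rank_inj; lia.
by lia.
Qed.

End Ranking.

(** * Trees are determined by their cuts *)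

Lemma fiberwise_injection (A B : finType) (K : eqType) (f : A -> K) (g : B ->
  K) :
  (forall c, #|[set a | f a == c]| <= #|[set b | g b == c]|) ->
  exists2 h : A -> B, injective h & forall a, g (h a) = f a.
Proof.
move=> fg; pose FA c := enum [set a | f a == c];
  pose FB c := enum [set b | g b == c].
(* Each element goes to the one at the same place in the enumeration of the corresponding fibre. *)
have ex a : exists b, b \in FB (f a) /\ index b (FB (f a)) = index a (FA (f a)).
  have lt : index a (FA (f a)) < size (FB (f a)).
    apply: leq_trans (_ : size (FA (f a)) <= _); last by rewrite -!cardE.
    by rewrite index_mem mem_enum inE.
  have [b0 _] : exists b0, b0 \in FB (f a).
    by case: (FB (f a)) lt => // b s _; exists b; rewrite mem_head.
  exists (nth b0 (FB (f a)) (index a (FA (f a)))).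
  by rewrite mem_nth // index_uniq ?enum_uniq.
have [h hP] := fin_all_exists ex.
have gh a : g (h a) = f a by case: (hP a); rewrite mem_enum inE => /eqP.
exists h => // a a' E; have faa' : f a' = f a by rewrite -!gh E.
have [_ ia] := hP a; have [_] := hP a'; rewrite faa' -E => ia';
  rewrite ia' in ia.
have inFA c : f c = f a -> c \in FA (f a) by rewrite mem_enum inE => ->.
by rewrite -(nth_index a (inFA a erefl)) -ia nth_index ?inFA.
Qed.

Lemma fiberwise_bijection (A B : finType) (K : eqType) (f : A -> K) (g : B ->
  K) :
  (forall c, #|[set a | f a == c]| = #|[set b | g b == c]|) ->
  exists2 h : A -> B, bijective h & forall a, g (h a) = f a.
Proof.
move=> fg;
  have [h h_inj gh] : exists2 h : A -> B, injective h & forall a, g (h a) = f a.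
  by apply: fiberwise_injection => c; rewrite fg.
have [h' /leq_card h'_inj _] : exists2 h : B -> A, injective h & forall a, f
  (h a) = g a.
  by apply: fiberwise_injection => c; rewrite fg.
by exists h => //; apply: inj_card_bij.
Qed.

Section CutReconstruction.

Definition rank_span (G : sgraph) (r : G -> nat) i j : nat :=
  #|[set e : G * G | [&& adj e.1 e.2, r e.1 == i & r e.2 == j]]|.

(* Adjacency can be read off the keys and the numbers of edges between two
   ranks, so a key-preserving bijection is an isomorphism. *)
Definition rank_key (G : sgraph) (r : G -> nat) (x : G) : nat * nat :=
  (r x, \max_(y | adj x y && (r x == 0)) r y).

Section OneGraph.
Variables (G : sgraph) (k : nat) (r : G -> nat).
Implicit Types (x y z : G).

(** The number of edges between two ranks is the mixed second difference of the cuts, written with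
    sums because subtraction on [nat] truncates. *)
Lemma rank_span_cut i j : i < j ->
  rank_span r i j + (cut r i j + (if i is i'.+1 then cut r i' j.-1 else 0)) =
  cut r i j.-1 + (if i is i'.+1 then cut r i' j else 0).
Proof.
move=> ij.
pose low i := #|[set e : G * G | [&& adj e.1 e.2, r e.1 <= i & r e.2 == j]]|.
have cutE i' : cut r i' j.-1 = low i' + cut r i' j.
  rewrite /cut /low -[LHS](cardsID [set e | r e.2 == j]); congr (_ + _);
    apply: eq_card => e;
  by rewrite !inE; case: (adj _ _) => //=; lia.
case: i ij => [|i] ij; rewrite !cutE.
  suff -> : rank_span r 0 j = low 0 by lia.
  by apply: eq_card => e; rewrite !inE leqn0.
suff : low i.+1 = rank_span r i.+1 j + low i by lia.
rewrite /low /rank_span -[LHS](cardsID [set e | r e.1 == i.+1]);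
  congr (_ + _); apply: eq_card => e;
by rewrite !inE; case: (adj _ _) => //=; lia.
Qed.

Hypotheses (treeG : is_tree G) (G_gt2 : 2 < #|G|) (rk : ranking k r).

Lemma cut_max i : cut r i k = 0.
Proof.
apply/eqP; rewrite cards_eq0; apply/eqP/setP => e; rewrite !inE.
by rewrite [k < _]ltnNge (rank_le rk) !andbF.
Qed.

Lemma rank_key_leaf x y : r x = 0 -> adj x y -> rank_key r x = (0, r y).
Proof.
move=> rx axy;
  have /leaf_neighbour[z axz zP] : x \in leaves G by rewrite -(rank_eq0 rk) rx.
rewrite /rank_key rx eqxx (zP _ axy) (eq_bigl (pred1 z)) ?big_pred1_eq // => w.
by rewrite andbT; apply/idP/eqP => [/zP|->].
Qed.

Lemma rank_key_interior x : 0 < r x -> rank_key r x = (r x, 0).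
Proof.
by move=> rx; rewrite /rank_key big_pred0 // => y; rewrite eqn0Ngt rx andbF.
Qed.

Lemma adj_leaf_rank x y : r x = 0 -> adj x y -> 0 < r y.
Proof.
move=> rx axy; rewrite (rank_gt0 rk) (leaf_adj_interior treeG G_gt2 _ axy) //.
by rewrite -(rank_eq0 rk) rx.
Qed.

Lemma leaf_adjE x y : r x = 0 ->
  adj x y = (0 < r y) && ((rank_key r x).2 == r y).
Proof.
move=> rx;
  have /leaf_neighbour[z axz zP] : x \in leaves G by rewrite -(rank_eq0 rk) rx.
rewrite (rank_key_leaf rx axz) /=; apply/idP/andP => [axy|[ry /eqP E]].
  by rewrite (adj_leaf_rank rx axy) -(zP _ axy).
by rewrite -(rank_inj rk _ E) // E.
Qed.

Lemma interior_adjE x y : 0 < r x -> 0 < r y ->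
  adj x y = (0 < rank_span r (r x) (r y)).
Proof.
move=> rx ry; apply/idP/card_gt0P => [axy|[[u v]]].
  by exists (x, y); rewrite inE /= axy !eqxx.
rewrite inE /= => /and3P[+ /eqP/esym ux /eqP/esym vy].
by rewrite -(rank_inj rk rx ux) -(rank_inj rk ry vy).
Qed.

Lemma card_leaf_key u : #|[set x | rank_key r x == (0, u)]| = rank_span r 0 u.
Proof.
rewrite /rank_span; set E := [set e : G * G | _].
rewrite -(card_in_imset (f := fst) (D := E)).
  apply: eq_card => x; rewrite inE; apply/eqP/imsetP => [xu|[[x' y]]].
    have rx : r x = 0 by case: xu.
    have /leaf_neighbour[y axy _] : x \in leaves G by rewrite -(rank_eq0 rk) rx.
    exists (x, y) => //; rewrite inE /= axy rx /=.
    by move: xu; rewrite (rank_key_leaf rx axy) => -[->].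
  by rewrite inE => /and3P[/= axy /eqP rx /eqP <-] ->;
    rewrite (rank_key_leaf rx axy).
move=> [x y] [x' y'];
  rewrite !inE /= => /and3P[axy /eqP rx _] /and3P[axy' _ _] E1.
rewrite -E1 in axy' *; congr (_, _).
have /leaf_neighbour[z axz zP] : x \in leaves G by rewrite -(rank_eq0 rk) rx.
by rewrite (zP _ axy) (zP _ axy').
Qed.

Lemma card_interior_key i u :
  #|[set x | rank_key r x == (i.+1, u)]| = (i < k) && (u == 0).
Proof.
have [/andP[ik /eqP->]|no] := boolP ((i < k) && (u == 0)).
  have [x rx] := rank_surj rk (j := i.+1) ik.
  rewrite (_ : [set _ | _] = [set x]) ?cards1 //; apply/setP => y; rewrite !inE.
  apply/eqP/eqP => [[ry _]|->]; last by rewrite rank_key_interior rx.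
  by apply: (rank_inj rk); rewrite ry.
apply/eqP; rewrite cards_eq0; apply/eqP/setP => y; rewrite !inE.
apply: contraNF no => /eqP E; have ry : r y = i.+1 by case: E.
by move: E; rewrite rank_key_interior ry // => -[<-]; rewrite -ry (rank_le rk).
Qed.

End OneGraph.

(** Equal cuts have equal second differences, so as many edges join two given ranks in [G] as in
    [H]. The fibres of the keys then have equal sizes and can be matched. *)
Lemma cut_isomorphic (G H : sgraph) (k : nat) (r : G -> nat) (s : H -> nat) :
  is_tree G -> 2 < #|G| -> ranking k r -> is_tree H -> 2 < #|H| -> ranking k s
    ->
  (forall i j, i <= j -> j < k -> cut r i j = cut s i j) -> isomorphic G H.
Proof.
move=> tG G2 rk tH H2 sk cutE.
have {}cutE i j : i <= j -> j <= k -> cut r i j = cut s i j.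
  rewrite [j <= k]leq_eqVlt => ij /predU1P[->|]; last exact: cutE.
  by rewrite (cut_max rk) (cut_max sk).
have spanE i j : i < j -> j <= k -> rank_span r i j = rank_span s i j.
  move=> ij jk; have := rank_span_cut s ij; have := rank_span_cut r ij.
  rewrite (cutE i j) ?(cutE i j.-1); try lia.
  by case: i ij => [|i] ij; [lia|rewrite (cutE i j) ?(cutE i j.-1); lia].
have [|h bij_h hP] := @fiberwise_bijection _ _ _ (rank_key r) (rank_key s).
  move=> [[|i] u];
    last by rewrite (card_interior_key rk) (card_interior_key sk).
  rewrite (card_leaf_key rk) (card_leaf_key sk).
  case: u => [|u].
    have no (K : sgraph) (t : K -> nat) : is_tree K -> 2 < #|K| -> ranking k t
      ->
        rank_span t 0 0 = 0.
      move=> tK K2 tk; apply/eqP; rewrite cards_eq0; apply/eqP/setP => e;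
        rewrite !inE.
      apply/negP => /and3P[ae /eqP re /eqP].
      by have := adj_leaf_rank tK K2 tk re ae; lia.
    by rewrite (no _ r) // (no _ s).
  have [uk|ku] := leqP u.+1 k; first exact: spanE.
  have no (K : sgraph) (t : K -> nat) : ranking k t -> rank_span t 0 u.+1 = 0.
    move=> tk; apply/eqP; rewrite cards_eq0; apply/eqP/setP => e; rewrite !inE.
    by apply/negP => /and3P[_ _ /eqP]; have := rank_le tk e.2; lia.
  by rewrite (no _ r) // (no _ s).
exists h => // x y.
have hr z : s (h z) = r z by case: (hP z).
have [rx|rx] := posnP (r x).
  by rewrite (leaf_adjE tH H2 sk) ?hr // (leaf_adjE tG G2 rk) // hP.
have [ry|ry] := posnP (r y).
  rewrite [LHS]adj_sym [RHS]adj_sym.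
  by rewrite (leaf_adjE tH H2 sk) ?hr // (leaf_adjE tG G2 rk) // hP ?hr.
wlog lexy : x y rx ry / r x <= r y.
  move=> W; case/orP: (leq_total (r x) (r y)) => /W; first exact.
  by rewrite adj_sym => ->; rewrite // adj_sym.
move: lexy; rewrite leq_eqVlt => /predU1P[E|lt].
  by rewrite (rank_inj rk rx E) !adj_irrefl.
rewrite (interior_adjE sk) ?hr // (interior_adjE rk) // spanE //.
exact: rank_le rk _.
Qed.

End CutReconstruction.

(** * Energy and minimizers *)

Local Open Scope ring_scope.

Section CutEnergy.
Variables (R : realType) (G : sgraph) (r : G -> nat) (k : nat).
Implicit Type a : nat -> R.

Lemma cut_sum i j : (cut r i j)%:R =
  \sum_x \sum_(y | adj x y) ((r x <= i)%N && (j < r y)%N)%:R :> R.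
Proof.
rewrite /cut -sum1_card natr_sum big_mkcond pair_big_dep [RHS]big_mkcond /=.
by apply: eq_bigr => e _; rewrite inE; case: (adj _ _) => //=; case: andP.
Qed.

Lemma sum_increments a u v : (v <= k)%N ->
  \sum_(i < k) (u <= i < v)%N%:R * (a i.+1 - a i) = if (u < v)%N then a v - a
    u else 0.
Proof.
move=> vk;
  rewrite -(big_mkord xpredT (fun i => (u <= i < v)%N%:R * (a i.+1 - a i))).
case: ltnP => [uv|vu]; last first.
  rewrite big1 // => i _; rewrite [(_ <= _ < _)%N](_ : _ = false) ?mul0r //;
    lia.
rewrite -(telescope_sumr _ (ltnW uv)).
rewrite (@big_cat_nat _ _ _ u) //=; last lia.
rewrite [X in X + _]big_nat [X in X + _]big1 ?add0r; last first.
  by move=> i iu; rewrite [(_ <= _ < _)%N](_ : _ = false) ?mul0r //; lia.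
rewrite (@big_cat_nat _ _ _ v) //=; last lia.
rewrite [X in _ + X]big_nat [X in _ + X]big1 ?addr0; last first.
  by move=> i iu; rewrite [(_ <= _ < _)%N](_ : _ = false) ?mul0r //; lia.
rewrite big_nat [RHS]big_nat; apply: eq_bigr => i iu.
by rewrite iu mul1r.
Qed.

Lemma energy_cut a : (forall x, r x <= k)%N ->
  \sum_x \sum_(y | adj x y) (a (r x) - a (r y)) ^+ 2 =
  2 * \sum_(i < k) \sum_(j < k) (cut r (minn i j) (maxn i j))%:R *
    ((a i.+1 - a i) * (a j.+1 - a j)).
Proof.
move=> rk; pose l i := a i.+1 - a i.
(* [Q u v] is the squared increase when [u < v] and 0 otherwise: of the two orientations of an edge
   only the rising one counts. *)
pose Q u v := (\sum_(i < k) (u <= i < v)%N%:R * l i) ^+ 2.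
have QE x y : (a (r x) - a (r y)) ^+ 2 = Q (r x) (r y) + Q (r y) (r x).
  by rewrite /Q /l !sum_increments //; case: ltngtP => [_|_|->]; ring.
under eq_bigr => x _ do under eq_bigr => y _ do rewrite QE.
under eq_bigr => x _ do rewrite big_split.
rewrite big_split /= [X in _ + X](exchange_big_dep xpredT) //=.
under [X in _ + X]eq_bigr => x _ do under eq_bigl => y do rewrite adj_sym.
rewrite -mulr2n [RHS]mulr_natl; congr (_ *+ _).
under [RHS]eq_bigr => i _ do under eq_bigr => j _ do rewrite cut_sum mulr_suml.
under [RHS]eq_bigr => i _ do under eq_bigr => j _ do under eq_bigr => x _ do
  rewrite mulr_suml.
under [RHS]eq_bigr => i _ do rewrite exchange_big.
rewrite [RHS]exchange_big; apply: eq_bigr => x _ /=.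
under [RHS]eq_bigr => i _ do rewrite exchange_big.
rewrite [RHS]exchange_big; apply: eq_bigr => y _ /=.
rewrite /Q expr2 mulr_suml; apply: eq_bigr => i _.
rewrite mulr_sumr; apply: eq_bigr => j _.
(* The increments [i] and [j] both lie on an edge exactly when it rises from at most [minn i j] to
   above [maxn i j]. *)
rewrite mulrACA -natrM mulnb; congr (_%:R * _); congr nat_of_bool; lia.
Qed.

Lemma sum_interior_rank (F : nat -> R) : ranking k r ->
  \sum_(x in interior_vertices G) F (r x) = \sum_(1 <= i < k.+1) F i.
Proof.
move=> rk; rewrite -big_enum /= -(big_map r xpredT) (perm_big _ (rank_perm rk)).
by rewrite /index_iota subSS subn0.
Qed.

End CutEnergy.

Section Minimizers.
Variables (R : realType) (G : sgraph).
Implicit Type f : G -> R.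

(** The reverse triangle inequality on each edge; the norm is unchanged. *)
Lemma rayleigh_abs f : rayleigh (fun x => `|f x|) <= rayleigh f.
Proof.
rewrite /rayleigh;
  under [X in _ / X <= _]eq_bigr => x _ do rewrite real_normK ?num_real //.
rewrite ler_wpM2r ?invr_ge0 ?sumr_ge0 // => [x _|]; first exact: sqr_ge0.
rewrite ler_wpM2l ?invr_ge0 // ler_sum // => x _; rewrite ler_sum // => y _.
rewrite -[leLHS]real_normK ?num_real // -[leRHS]real_normK ?num_real //.
by rewrite ler_sqr ?nnegrE // ler_dist_dist.
Qed.

Lemma sum_interior_gt0 f : (exists x, f x != 0) -> dirichlet_fun f ->
  0 < \sum_(x in interior_vertices G) f x ^+ 2.
Proof. by move=> [x fx] f0; rewrite -dot_interior //; exact: dot_gt0 fx. Qed.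

Lemma lambda1_nonneg_minimizer : interior_vertices G != set0 ->
  exists f, [/\ exists x, f x != 0, dirichlet_fun f, forall x, 0 <= f x &
    rayleigh f = lambda1 R G].
Proof.
move=> /(lambda1P R)[_ _ [f [[x fx] f0 fE]] lam_le].
exists (fun x => `|f x|).
have n0 : exists x, `|f x| != 0 by exists x; rewrite normr_eq0.
have d0 : dirichlet_fun (fun x => `|f x|) by move=> y /f0 ->; rewrite normr0.
split=> //; apply/eqP; rewrite eq_le lam_le // andbT -fE; exact: rayleigh_abs.
Qed.

(** First variation: moving [f] along the indicator [h] of [x] keeps the energy minus [2 * lam]
    times the squared norm nonnegative, so the linear coefficient [B] is 0. *)
Lemma minimizer_eigen f : interior_vertices G != set0 ->
  (exists x, f x != 0) -> dirichlet_fun f -> rayleigh f <= lambda1 R G ->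
  forall x, x \in interior_vertices G -> - laplacian f x = lambda1 R G * f x.
Proof.
move=> /(lambda1P R)[_ _ _ lam_le] fN0 f0 f_le x xI.
set lam := lambda1 R G in lam_le f_le *.
pose E (g h : G -> R) : R := \sum_x \sum_(y | adj x y) (g x - g y) * (h x - h
  y).
pose D (g h : G -> R) : R := \sum_x g x * h x.
have rayE g : dirichlet_fun g -> rayleigh g = 2^-1 * E g g / D g g.
  by move=> g0; rewrite /rayleigh -dot_interior.
have le_E g : dirichlet_fun g -> 2 * lam * D g g <= E g g.
  move=> g0; have [/existsP[y gy]|gz] := boolP [exists y, g y != 0].
    have := lam_le g (ex_intro _ y gy) g0;
      rewrite rayE // ler_pdivlMr ?(dot_gt0 gy) //.
    by rewrite ler_pdivlMl //; lra.
  have {}gz y : g y = 0 by apply/eqP/negPn; apply: contra gz => gy;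
    apply/existsP; exists y.
  by rewrite /E /D !big1 ?mulr0 // => y _;
    rewrite ?gz ?mul0r // big1 // => z _; rewrite !gz subrr mul0r.
have fE : E f f = 2 * lam * D f f.
  apply/eqP; rewrite eq_le le_E // andbT.
  case: fN0 => y fy; move: f_le; rewrite rayE // ler_pdivrMr ?(dot_gt0 fy) //.
  by rewrite ler_pdivrMl //; lra.
pose h y : R := (y == x)%:R.
have h0 : dirichlet_fun h.
  move=> y yL; rewrite /h; case: eqP => // yx; move: xI.
  by rewrite -yx in_setC yL.
have Dfh : D f h = f x.
  rewrite /D (bigD1 x) //= big1 ?addr0 /h ?eqxx ?mulr1 // => y /negPf->.
  by rewrite mulr0.
have Efh : E f h = 2 * - laplacian f x.
  rewrite /E green (bigD1 x) //= big1 ?addr0 /h ?eqxx ?mul1r // => y /negPf->.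
  by rewrite mul0r.
pose B := E f h - 2 * lam * D f h; pose C := E h h - 2 * lam * D h h.
have quad s : 0 <= 2 * s * B + s ^+ 2 * C.
  have /le_E : dirichlet_fun (fun y => f y + s * h y).
    by move=> y yL; rewrite f0 // h0 // mulr0 addr0.
  rewrite /E /D energyDZ dotDZ -/(E f f) -/(E f h) -/(E h h) -/(D f f) -/(D f
    h) -/(D h h).
  rewrite fE /B /C; lra.
have C0 : 0 <= C by rewrite subr_ge0 le_E.
suff : B = 0 by rewrite /B Dfh Efh; lra.
(* The denominator [C + 1] stays positive even if [C = 0]. *)
have := quad (- B / (C + 1)).
have -> : 2 * (- B / (C + 1)) * B + (- B / (C + 1)) ^+ 2 * C =
  - (B ^+ 2 * (C + 2)) / (C + 1) ^+ 2 by field; lra.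
rewrite mulNr oppr_ge0 pmulr_lle0 ?invr_gt0 ?exprn_gt0; try lra.
rewrite pmulr_lle0; try lra.
by rewrite real_exprn_even_le0 ?num_real //= => /eqP.
Qed.

End Minimizers.

(** * The path trees *)

Section PathTreeFacts.
Local Open Scope nat_scope.
Variables p q b : nat.
Hypotheses (q_ge2 : 2 <= q) (q_le_b : q <= b).
Let T := path_tree p q b.

Lemma pendant_at_lt c : pendant_at p q c < p + q.
Proof. by rewrite /pendant_at; case: eqP => _; [|case: (ltnP c)]; lia. Qed.

Lemma path_tree_is_tree : is_tree T.
Proof.
have n0 : 0 < p + q by lia.
split.
- by rewrite card_sum !card_ord; lia.
- have sym : connect_sym (@adj T) by apply: sym_connect_sym; exact: adj_sym.
  suff to0 (x : T) : connect (@adj T) (inl (Ordinal n0)) x.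
    by move=> x y; apply: connect_trans (to0 y); rewrite sym.
  have toL i (lt : i < p + q) : connect (@adj T) (inl (Ordinal n0)) (inl
    (Ordinal lt)).
    elim: i lt => [|i IHi] lt;
      first by rewrite (bool_irrelevance lt n0) connect0.
    apply: connect_trans (IHi (ltnW lt)) _; apply: connect1.
    by rewrite /adj /= eqxx.
  case: x => [[i lt]|c]; first exact: toL.
  apply: connect_trans (toL _ (pendant_at_lt c)) _; apply: connect1.
  by rewrite /adj /= eqxx.
- pose o (x : T) := match x with inl i => val i | inr c => p + q end.
  apply: (@order_acyclic T o) => -[i|c] [j|d] [l|e] //=.
  + move=> ij il ji li; congr inl; apply: val_inj => /=; lia.
  + by move=> _ _ _; have := ltn_ord i; lia.
  + by move=> _ _ ; have := ltn_ord i; lia.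
  + by move=> _ _ ; have := ltn_ord i; lia.
  + by move=> /eqP ji /eqP li _ _; congr inl; apply: val_inj; rewrite /= ji li.
Qed.

Lemma card_path_tree : #|T| = p + q + b.
Proof. by rewrite card_sum !card_ord. Qed.

Lemma leaves_path_tree (x : T) : (x \in leaves T) = (if x is inr _ then true
  else false).
Proof.
case: x => [i|c]; rewrite inE; last first.
  apply/cards1P; exists (inl (Ordinal (pendant_at_lt c))); apply/setP => -[j|d].
    by rewrite !inE /adj /=; apply/eqP/eqP => [E|[->]] //; congr inl;
      apply: val_inj.
  by rewrite !inE.
suff [y [z [yz ay az]]] : exists y z : T, [/\ y != z, adj (inl i : T) y & adj
  (inl i : T) z].
  apply/negbTE; rewrite neq_ltn; apply/orP; right; apply/card_gt1P.
  by exists y, z; rewrite !inE.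
have b0 : 0 < b by lia.
have bq : q.-1 < b by lia.
have [i0|i0] := posnP i.
  have lt : i.+1 < p + q by lia.
  by exists (inl (Ordinal lt)), (inr (Ordinal b0));
    rewrite /adj /= eqxx /pendant_at /= i0.
have lt : i.-1 < p + q by have := ltn_ord i; lia.
have [il|il] := ltnP i.+1 (p + q).
  exists (inl (Ordinal lt)), (inl (Ordinal il)); split; rewrite /adj /=;
    try lia.
  by apply/eqP => -[]; lia.
exists (inl (Ordinal lt)), (inr (Ordinal bq)); split; rewrite /adj //=; try lia.
rewrite /pendant_at ltnn; have -> : q.-1 == 0 = false by lia.
by have := ltn_ord i; lia.
Qed.

Lemma card_leaves_path_tree : #|leaves T| = b.
Proof.
rewrite -[RHS]card_ord -(card_imset _ (@inr_inj 'I_(p + q) 'I_b)).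
apply: eq_card => -[i|c]; rewrite leaves_path_tree; apply/esym.
  by apply/imsetP => -[].
by apply/imsetP; exists c.
Qed.

Lemma card_interior_path_tree : #|interior_vertices T| = p + q.
Proof.
have := card_interior T; rewrite card_leaves_path_tree card_path_tree; lia.
Qed.

Lemma path_tree_gt2 : 2 < #|T|. Proof. by rewrite card_path_tree; lia. Qed.

Lemma card_supports_path_tree : #|support_vertices T| <= q.
Proof.
pose h (c : 'I_q) : T := inl (Ordinal (pendant_at_lt c)).
rewrite -[q in _ <= q]card_ord; apply: leq_trans (leq_imset_card h predT).
apply: subset_leq_card; apply/subsetP => x; rewrite inE => /existsP[y].
rewrite leaves_path_tree; case: y => // c /=; case: x => // i;
  rewrite /adj /= => /eqP ic.
(* All pendant vertices of index at least [q - 1] hang at the end of the path. *)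
have lt : minn c q.-1 < q by lia.
apply/imsetP; exists (Ordinal lt) => //; congr inl; apply: val_inj;
  rewrite /= ic.
rewrite /pendant_at; case: (leqP c q.-1) => cq //.
by rewrite ltnn; case: (ltnP c); case: eqP; case: eqP; lia.
Qed.

(** One leaf edge at each of the [q] support vertices, and every other edge of the bare part, whose
    0-based positions are 1 to [p]. *)
Lemma matching_path_tree_ge : q + p./2 <= matching_number T.
Proof.
have o1 (s : 'I_(p./2)) : (s.*2).+1 < p + q by have := ltn_ord s; lia.
have o2 (s : 'I_(p./2)) : (s.*2).+2 < p + q by have := ltn_ord s; lia.
pose u (z : 'I_q + 'I_(p./2)) : T := match z with
  | inl c => inl (Ordinal (pendant_at_lt c)) | inr s => inl (Ordinal (o1 s))
    end.
pose v (z : 'I_q + 'I_(p./2)) : T := match z with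
  | inl c => inr (widen_ord q_le_b c) | inr s => inl (Ordinal (o2 s)) end.
have inlE (x y : 'I_(p + q)) : ((inl x : T) == inl y) = (x == y :> nat) by [].
have pend (c : 'I_q) : pendant_at p q c =
    if c == 0 :> nat then 0 else p + c.
  rewrite /pendant_at; case: eqP => // _; case: ltnP => //.
  by have := ltn_ord c; lia.
rewrite -[q]card_ord -[p./2]card_ord -card_sum.
apply: (@leq_matching_number _ _ u v) => [[c|s]|[c|s] [d|t]];
  rewrite /adj /= ?eqxx //.
- move=> cd; have {}cd : c != d :> nat by []; split=> //.
  by rewrite inlE /= !pend; case: (eqVneq (c : nat) 0);
    case: (eqVneq (d : nat) 0); lia.
- move=> _; rewrite !inlE /= !pend; have := ltn_ord t.
  by split=> //; case: (eqVneq (c : nat) 0); lia.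
- move=> _; rewrite !inlE /= !pend; have := ltn_ord s.
  by split=> //; case: (eqVneq (d : nat) 0); lia.
- by move=> st; rewrite !inlE /= ; have {st} : s != t :> nat by []; split; lia.
Qed.

Lemma matching_path_tree : matching_number T = q + p./2.
Proof.
apply/eqP; rewrite eqn_leq matching_path_tree_ge andbT.
have := matching_number_supports T.
rewrite card_leaves_path_tree card_path_tree; have := card_supports_path_tree.
lia.
Qed.

Lemma path_tree_class n m : n = p + q + b -> m = q + p./2 ->
  tree_class n m b T.
Proof.
move=> -> ->; split; [exact: path_tree_is_tree|exact: card_path_tree|
  exact: matching_path_tree|exact: card_leaves_path_tree].
Qed.

(* In increasing order of the first Dirichlet eigenfunction: up along the
   caterpillar part [u_(p+q), ..., u_(p+2)], then alternately on the two sides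
   of the bare part, [u_1, u_(p+1), u_2, u_p, u_3, ...]. *)
Definition path_rank i := if p < i then p + q - i else
  if i.*2 <= p then q + i.*2 else (q + (p - i).*2).+1.

Definition vertex_rank (x : T) := if x is inl i then path_rank i else 0.

Lemma path_rank_bounds i : i < p + q -> 0 < path_rank i <= p + q.
Proof. by clear q_le_b; rewrite /path_rank; case: (ltnP p i);
  case: (leqP i.*2 p); lia. Qed.

Lemma path_rank_inj i j : i < p + q -> j < p + q -> path_rank i = path_rank j
  -> i = j.
Proof.
by rewrite /path_rank; case: (ltnP p i); case: (leqP i.*2 p); case: (ltnP p j);
  case: (leqP j.*2 p); lia.
Qed.

Lemma path_ranking : ranking (p + q) vertex_rank.
Proof.
split.
- move=> [i|c]; rewrite leaves_path_tree //=.
  by have := path_rank_bounds (ltn_ord i); lia.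
- move=> [i|c] [j|d]; rewrite !in_setC !leaves_path_tree //= => _ _.
  by move/(path_rank_inj (ltn_ord i) (ltn_ord j)) => ij; congr inl;
    apply: val_inj.
- by move=> [i|c] //=; case/andP: (path_rank_bounds (ltn_ord i)).
- exact: card_interior_path_tree.
Qed.

Lemma path_rank_pendant c : path_rank (pendant_at p q c) = maxn (q - c) 1.
Proof.
rewrite /pendant_at; case: eqP => [->|c0]; first by rewrite /path_rank /=; lia.
case: (ltnP c q.-1) => cq; rewrite /path_rank.
  by case: (ltnP p (p + c)); lia.
by case: (ltnP p (p + q).-1); lia.
Qed.

(** In turn: an edge of the caterpillar part; an edge on one of the two sides, where the alternation
    makes ranks jump by two; the edge at which the sides meet. *)
Lemma path_rank_adj i j : i < p + q -> j < p + q -> (j == i.+1) || (i == j.+1)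
  ->
  path_rank i < path_rank j ->
  [|| ((path_rank i).+1 < q) && (path_rank j == (path_rank i).+1),
      (q <= (path_rank i).+1) && (path_rank j == (path_rank i).+2)
    | [&& q <= (path_rank i).+1, (path_rank i).+1 == p + q & path_rank j == p
      + q]].
Proof.
rewrite /path_rank; case: (ltnP p i); case: (leqP i.*2 p); case: (ltnP p j);
  case: (leqP j.*2 p); lia.
Qed.

Lemma card_ord_lt (n m : nat) : #|[set c : 'I_n | c < m]| <= m.
Proof.
rewrite -[leqRHS](size_iota 0) cardE -(size_map val); apply: uniq_leq_size.
  by rewrite map_inj_uniq ?enum_uniq //; apply: val_inj.
by move=> _ /mapP[c + ->]; rewrite mem_enum inE mem_iota.
Qed.

(** Leaf edges are counted by the pendant vertices attached above rank [j], path edges by their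
    pairs of ranks, which [path_rank_adj] restricts to the list [S]. *)
Lemma path_tree_cut_le i j : i <= j -> j < p + q ->
  cut vertex_rank i j <= min_cut q b i j.
Proof.
move=> ij jk; rewrite /cut; set C := [set e | _].
pose X : {set T * T} := [set e | if e.1 is inr _ then true else false].
rewrite -(cardsID X C).
pose D := [set c : 'I_b | j < path_rank (pendant_at p q c)].
have leafC : #|C :&: X| <= #|D|.
  rewrite -(card_imset _ (@inr_inj 'I_(p + q) 'I_b)).
  rewrite -(card_in_imset (f := fst)).
    apply: subset_leq_card; apply/subsetP => _ /imsetP[[x y] + ->];
      rewrite !inE.
    case: x => [?|c]; rewrite ?andbF //; case: y => [d|//].
    rewrite /adj /= => /andP[/andP[/eqP E jd] _].
    by apply/imsetP; exists c; rewrite // inE -E.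
  move=> [x y] [x' y']; rewrite !inE.
  case: x x' y y' => [?|c] [?|c'] [d|?] [d'|?]; rewrite /adj ?andbF //=.
  move=> /andP[/andP[/eqP E _] _] /andP[/andP[/eqP E' _] _] [cc'].
  by rewrite cc' in E *; congr (_, inl _); apply: val_inj; rewrite /= E E'.
have cardD : #|D| <= if j == 0 then b else q - j.
  case: eqP => [_|j0]; first by rewrite -[leqRHS]card_ord max_card.
  apply: leq_trans (card_ord_lt b (q - j)); apply: subset_leq_card.
  by apply/subsetP => c; rewrite !inE path_rank_pendant; lia.
pose S := if i == j then
    if j == 0 then [::]
    else if j.+1 < q then [:: (j, j.+1)]
    else let last := (j, if j.+1 == p + q then j.+1 else j.+2) in
      if j < q then [:: last] else [:: (j.-1, j.+1); last]
  else if (i.+1 == j) && (q <= j) then [:: (i, j.+1)] else [::].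
have interiorC : #|C :\: X| <= size S.
  rewrite cardE -(size_map (fun e => (vertex_rank e.1, vertex_rank e.2))).
  apply: uniq_leq_size.
    rewrite map_inj_in_uniq ?enum_uniq // => -[x y] [x' y'].
    rewrite !mem_enum !inE.
    case: x x' y y' => [c|?] [c'|?] [d|?] [d'|?];
      rewrite ?ltn0 ?andbF //= => _ _ [].
    move/(path_rank_inj (ltn_ord c) (ltn_ord c')) => cc'.
    move/(path_rank_inj (ltn_ord d) (ltn_ord d')) => dd'.
    by congr (inl _, inl _); apply: val_inj.
  move=> _ /mapP[[x y] + ->]; rewrite mem_enum !inE.
  case: x y => [c|?] [d|?]; rewrite ?ltn0 ?andbF //= /adj /=.
  move=> /and3P[acd rc rd].
  have := path_rank_adj (ltn_ord c) (ltn_ord d) acd ltac:(lia).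
  have := path_rank_bounds (ltn_ord c); have := path_rank_bounds (ltn_ord d).
  move: (path_rank c) (path_rank d) rc rd => r s; clear -jk ij q_ge2 q_le_b;
    rewrite /S.
  have [->|nij] := eqVneq i j; last first.
    by have [/andP[/eqP ij' qj]|no] := boolP ((i.+1 == j) && (q <= j));
      rewrite ?inE ?xpair_eqE; lia.
  have [?|?] := eqVneq j 0; first lia.
  have [?|?] := ltnP j.+1 q; first by rewrite ?inE ?xpair_eqE; lia.
  by have [?|?] := ltnP j q; have [?|?] := eqVneq j.+1 (p + q);
    rewrite !inE ?xpair_eqE; lia.
apply: leq_trans (leq_add leafC interiorC) _.
move: cardD; rewrite /min_cut /S; have [_|nij] := eqVneq i j.
  have [_|j0] := eqVneq j 0; first by rewrite addn0.
  by have [?|?] := ltnP j.+1 q; [|have [?|?] := ltnP j q] => /=; lia.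
have [?|_] := eqVneq j 0; first lia.
by have [?|?] := eqVneq i.+1 j => /=; [have [?|?] := leqP q j => /=|]; lia.
Qed.

End PathTreeFacts.

Section PathTreeEigen.
Variables (R : realType) (p q b : nat).
Hypotheses (q_ge2 : (2 <= q)%N) (q_le_b : (q <= b)%N).
Let T := path_tree p q b.

Definition pendants (i : nat) : nat :=
  if i.+1 == (p + q)%N then (b.+1 - q)%N else ~~ (0 < i <= p)%N.

Lemma card_pendants i : (i < p + q)%N ->
  #|[set c : 'I_b | i == pendant_at p q c]| = pendants i.
Proof.
move=> ilt; rewrite /pendants; case: eqP => [iE|iN].
  transitivity #|[set c : 'I_b | ~~ (c < q.-1)%N]|.
    apply: eq_card => c; rewrite !inE /pendant_at.
    by case: (eqVneq (c : nat) 0%N) => c0; case: (ltnP c q.-1); lia.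
  have lt : (q.-1 <= b)%N by lia.
  have -> : [set c : 'I_b | ~~ (c < q.-1)%N] = ~: [set widen_ord lt c | c in
    'I_(q.-1)].
    apply/setP => c; rewrite !inE; congr (~~ _);
      apply/idP/imsetP => [cq|[d _ ->]].
      by exists (Ordinal cq) => //; apply: val_inj.
    exact: (ltn_ord d).
  rewrite cardsCs setCK card_imset ?card_ord; first lia.
  by move=> c d /(congr1 val) /= E; apply: val_inj.
have [ip|ip] /= := boolP (0 < i <= p)%N.
  apply/eqP; rewrite cards_eq0; apply/eqP/setP => c; rewrite !inE /pendant_at.
  by case: (eqVneq (c : nat) 0%N) => c0; case: (ltnP c q.-1); lia.
have lt : (i - p < b)%N by lia.
rewrite (_ : [set _ | _] = [set Ordinal lt]) ?cards1 //; apply/setP => c.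
rewrite !inE -val_eqE /= /pendant_at.
by case: (eqVneq (c : nat) 0%N) => c0; case: (ltnP c q.-1); lia.
Qed.

Lemma path_tree_laplacian (f : T -> R) (x : nat -> R) (i : 'I_(p + q)) :
  dirichlet_fun f -> (forall j : 'I_(p + q), f (inl j) = x j) ->
  - laplacian f (inl i : T) = (if (0 < i)%N then x i - x i.-1 else 0) +
    (if (i.+1 < p + q)%N then x i - x i.+1 else 0) + (pendants i)%:R * x i.
Proof.
move=> f0 fx; rewrite /laplacian -sumrN big_sumType /=; congr (_ + _);
  last first.
  rewrite -card_pendants ?ltn_ord // mulr_natl -sumr_const.
  apply: eq_big => [c|c _]; first by rewrite inE.
  by rewrite f0 ?leaves_path_tree // fx sub0r opprK.
(* For [i = 0] the predecessor [i.-1] is [i] itself; the inner test discards this term. *)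
have splitE (j : 'I_(p + q)) : (if (j == i.+1 :> nat) || (i == j.+1 :> nat)
      then - (f (inl j) - f (inl i)) else 0) =
    (if j == i.-1 :> nat then if (0 < i)%N then x i - x i.-1 else 0 else 0) +
    (if j == i.+1 :> nat then x i - x i.+1 else 0).
  rewrite !fx opprB; case: (eqVneq (j : nat) i.+1) => [->|ji] /=.
    by rewrite [_ == i.-1](_ : _ = false) ?add0r //; lia.
  rewrite addr0; case: (eqVneq (i : nat) j.+1) => [->|ij] /=;
    first by rewrite eqxx.
  by case: eqP => // jE; case: ltnP => // i0; lia.
rewrite big_mkcond /= (eq_bigr _ (fun j _ => splitE j)) big_split /=
  -!big_mkcond /=.
rewrite (big_ord1_eq _ (fun=> if (0 < i)%N then _ else _)).
rewrite (big_ord1_eq _ (fun=> x i - x i.+1)).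
by rewrite (leq_ltn_trans (leq_pred i)).
Qed.

End PathTreeEigen.

(** * Strictly increasing values *)

Section StrictMonotonicity.
Variables (R : realType) (p q b : nat) (a : nat -> R) (lam : R).
Hypotheses (q_ge2 : (2 <= q)%N) (q_le_b : (q <= b)%N).
Let x i := a (path_rank p q i).

Hypothesis a0 : a 0 = 0.
Hypothesis a_mono : {in [pred i | i <= p + q]%N &, {homo a : i j / (i <= j)%N
  >-> i <= j}}.
Hypothesis a_top : 0 < a (p + q)%N.
Hypothesis eigen : forall i, (i < p + q)%N ->
  (if (0 < i)%N then x i - x i.-1 else 0) +
  (if (i.+1 < p + q)%N then x i - x i.+1 else 0) +
  (pendants p q b i)%:R * x i = lam * x i.

Lemma position_mono i j : (i < p + q)%N -> (j < p + q)%N ->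
  (path_rank p q i <= path_rank p q j)%N -> x i <= x j.
Proof.
move=> iK jK; apply: a_mono; rewrite inE.
  by case/andP: (path_rank_bounds q_ge2 iK).
by case/andP: (path_rank_bounds q_ge2 jK).
Qed.

Lemma position_ge0 i : (i < p + q)%N -> 0 <= x i.
Proof.
move=> iK; rewrite -a0; apply: a_mono => //; rewrite inE.
by case/andP: (path_rank_bounds q_ge2 iK).
Qed.

(** Minimum principle: at a zero the equation makes the neighbouring nonnegative values vanish, so
    zeros spread along the path up to the vertex of top rank. *)
Lemma position_gt0 i : (i < p + q)%N -> 0 < x i.
Proof.
move=> iK; rewrite lt_def position_ge0 // andbT; apply/eqP => xi.
have zero j : (j < p + q)%N -> x j = 0 ->
    ((0 < j)%N -> x j.-1 = 0) /\ ((j.+1 < p + q)%N -> x j.+1 = 0).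
  move=> jK xj; have := eigen jK; rewrite xj !mulr0 !sub0r addr0.
  have xp : 0 <= x j.-1 by apply: position_ge0; lia.
  have [jn|jn] := ltnP j.+1 (p + q).
    by have := position_ge0 jn; case: ltnP => // _; split=> // _; lra.
  by case: ltnP => // _; split=> // _; lra.
have x0 : x 0 = 0.
  elim: i iK xi => // i IHi iK xi; apply: IHi; first lia.
  by case: (zero _ iK xi) => + _; apply.
have {}zero j : (j < p + q)%N -> x j = 0.
  by elim: j => // j IHj jK; case: (zero j _ (IHj _)) => [||_]; [lia|lia|apply].
(* The top rank lies where the two alternating sides meet, which depends on the parity of [p]. *)
have [j jK jE] : exists2 j, (j < p + q)%N & path_rank p q j = (p + q)%N.
  exists (if odd p then (p.+1)./2 else p./2); first by case: ifP; lia.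
  rewrite /path_rank; case: (boolP (odd p)) => op.
    by case: (ltnP p (p.+1)./2); case: (leqP (p.+1)./2.*2 p); lia.
  by case: (ltnP p p./2); case: (leqP p./2.*2 p); lia.
by have := zero j jK; rewrite /x jE => E; move: a_top; rewrite E ltxx.
Qed.

Section NoBarePart.
Hypotheses (p0 : p = 0%N) (q_lt_b : (q < b)%N).

(** The first decrement is [(lam - 1) * x 0], and each equation adds a multiple of [lam - 1] to the
    next. If [lam = 1], the values would be constant, against the last equation, since the end
    carries at least 2 leaves. *)
Lemma caterpillar_increments : 1 < lam /\
  forall i, (i.+1 < q)%N -> x i.+1 < x i.
Proof.
have rk i : path_rank p q i = (q - i)%N.
  by rewrite /path_rank p0; case: (ltnP 0 i); case: (leqP i.*2 0); lia.
have e0 : x 0 - x 1 = (lam - 1) * x 0.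
  have := eigen (i := 0) ltac:(lia); rewrite /pendants p0 /=.
  by case: ltnP => [_|]; [|lia]; case: eqP => [|_]; [lia|]; rewrite /=; lra.
have e i : (i.+2 < q)%N -> x i.+1 - x i.+2 = x i - x i.+1 + (lam - 1) * x i.+1.
  move=> iq; have := eigen (i := i.+1) ltac:(lia); rewrite /pendants p0 /=.
  by case: ltnP => [_|]; [|lia]; case: eqP => [|_]; [lia|]; rewrite /=; lra.
have el : x q.-2 - x q.-1 = (b.+1 - q)%:R * x q.-1 - lam * x q.-1.
  have := eigen (i := q.-1) ltac:(lia); rewrite /pendants p0 /=.
  case: (ltnP 0) => [_|]; [|lia]; case: ltnP => [|_]; [lia|];
    case: eqP => [_|]; [|lia].
  by rewrite /=; lra.
have xq : 0 < x q.-1 by apply: position_gt0; lia.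
have lam1 : 1 <= lam.
  have x00 : 0 < x 0 by apply: position_gt0; lia.
  have : x 1 <= x 0 by apply: position_mono; rewrite ?rk; lia.
  by rewrite -(subr_ge0 (x 1)) e0 pmulr_lge0 // subr_ge0.
have inc i : (i.+1 < q)%N -> x i - x i.+1 >= (lam - 1) * x i.
  elim: i => [|i IHi] iq; first by rewrite e0.
  have xi : 0 < x i by apply: position_gt0; lia.
  have := IHi ltac:(lia); have : 0 <= (lam - 1) * x i by apply: mulr_ge0;
    [rewrite subr_ge0|exact: ltW].
  by rewrite e //; lra.
have lam_gt1 : 1 < lam.
  rewrite lt_def lam1 andbT; apply/eqP => lamE.
  have inc0 i : (i.+1 < q)%N -> x i - x i.+1 = 0.
    elim: i => [|i IHi] iq; first by rewrite e0 lamE; lra.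
    by rewrite e // IHi ?lamE; [lra|lia].
  have := inc0 q.-2 ltac:(lia); rewrite (_ : q.-2.+1 = q.-1); last lia.
  rewrite el lamE => /eqP; rewrite -mulrBl mulf_eq0 => /orP[|/eqP xq0];
    last lra.
  rewrite subr_eq0 -[1]/(1%:R) eqr_nat; lia.
split=> // i iq; have xi : 0 < x i by apply: position_gt0; lia.
rewrite -subr_gt0; apply: lt_le_trans (inc i iq).
by rewrite mulr_gt0 // subr_gt0.
Qed.

End NoBarePart.

Section BarePart.
Hypotheses (p_gt0 : (0 < p)%N) (b_gt2 : (2 < b)%N).

(* Shifted by one so that the pendant vertex at [u_1] gets the index 0. *)
Let y i := if i is i'.+1 then x i' else 0.

Lemma bare_recurrence i : (0 < i <= p.+1)%N ->
  y i.-1 + y i.+1 = (2 - lam) * y i.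
Proof.
case: i => [|[|i]] //= ip.
  have := eigen (i := 0) ltac:(lia); rewrite /pendants /=.
  by case: ltnP => [_|]; [|lia]; case: eqP => [|_]; [lia|]; rewrite /=; lra.
have := eigen (i := i.+1) ltac:(lia); rewrite /pendants /=.
case: ltnP => [_|]; [|lia]; case: eqP => [|_]; [lia|];
  case: (ltnP i p) => [_|]; [|lia].
by rewrite /=; lra.
Qed.

Lemma tail_recurrence i : (p < i)%N -> (i.+1 < p + q)%N ->
  x i.-1 + x i.+1 = (3 - lam) * x i.
Proof.
move=> pi iK; have := eigen (i := i) ltac:(lia); rewrite /pendants iK.
case: ltnP => [_|]; [|lia]; case: eqP => [|_]; [lia|]; case: leqP => [|_];
  [lia|].
by rewrite /=; lra.
Qed.

Lemma end_equation :
  x (p + q).-2 = ((b.+1 - q)%:R + 1 - lam) * x (p + q).-1.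
Proof.
have := eigen (i := (p + q).-1) ltac:(lia); rewrite /pendants.
case: (ltnP 0) => [_|]; [|lia]; case: ltnP => [|_]; [lia|]; case: eqP => [_|];
  [|lia].
by rewrite /=; lra.
Qed.

(** The reflection of index [i] to [p + 2 - i] preserves the recurrence. The rank order gives the
    weak inequality; equality at [i + 1] would equate the two sums of neighbours, so the strict
    inequality at [i] would be reversed at [i + 2]. *)
Lemma left_lt_right i : (i.*2 < p.+2)%N -> y i < y (p.+2 - i)%N.
Proof.
have rightE j : (j < p.+2)%N -> y (p.+2 - j) = x (p.+1 - j)%N.
  by move=> jp; rewrite subSn.
have le j : (j.*2 <= p.+2)%N -> y j <= y (p.+2 - j)%N.
  case: j => [|j] jp; first by rewrite rightE //; apply: position_ge0; lia.
  rewrite rightE; last lia.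
  apply: position_mono; try lia; rewrite /path_rank.
  case: (ltnP p j); case: (leqP j.*2 p); case: (ltnP p (p.+1 - j.+1));
    case: (leqP (p.+1 - j.+1).*2 p); lia.
elim: i => [|i IHi] ip; first by rewrite rightE //; apply: position_gt0; lia.
rewrite lt_def le ?(ltnW ip) // andbT; apply/eqP => E.
have r1 := bare_recurrence (i := i.+1) ltac:(lia).
have r2 := bare_recurrence (i := p.+2 - i.+1)%N ltac:(lia).
rewrite E -r1 in r2.
have lt1 : y i < y (p.+2 - i)%N by apply: IHi; lia.
rewrite [(p.+2 - i.+1).+1](_ : _ = p.+2 - i)%N in r2; last lia.
rewrite [(p.+2 - i.+1).-1](_ : _ = p.+2 - i.+2)%N in r2; last lia.
have [ip2|ip2] := leqP i.+2.*2 p.+2; first by have := le i.+2 ip2;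
  move: r2 => /=; lra.
(* At the middle, [i + 1] and [i + 2] are mirror images of each other. *)
have i2 : (p.+2 - i.+2)%N = i.+1 by lia.
have i2' : (p.+2 - i.+1)%N = i.+2 by lia.
move: r2 E; rewrite i2 i2' /=; lra.
Qed.

(** [x 0 < x p <= x 1] by reflection and rank order, while the equation at [u_1] gives
    [x 1 = (2 - lam) * x 0]. *)
Lemma lam_lt1 : lam < 1.
Proof.
have := left_lt_right (i := 1) ltac:(lia); rewrite subSS /= ?subn0 => x0p.
have x0 : 0 < x 0 by apply: position_gt0; lia.
have : x p <= x 1.
  apply: position_mono; try lia; rewrite /path_rank.
  case: (ltnP p p); case: (leqP p.*2 p); case: (ltnP p 1);
    case: (leqP 1.*2 p); lia.
have := bare_recurrence (i := 1) ltac:(lia); rewrite /= add0r => r1 xp1.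
by rewrite -subr_gt0 -(pmulr_lgt0 _ x0); lra.
Qed.

(** If two consecutive values were equal, the second vertex would have a leaf and otherwise only
    neighbours that are not larger, which forces [lam >= 1]. *)
Lemma tail_lt i : (p < i)%N -> (i.+1 < p + q)%N -> x i.+1 < x i.
Proof.
have rk j : (p < j)%N -> path_rank p q j = (p + q - j)%N.
  by rewrite /path_rank => ->.
have lam1 := lam_lt1.
move=> pi iK; rewrite lt_def; apply/andP; split; last first.
  by apply: position_mono; rewrite ?rk; lia.
apply/eqP => E; have xi : 0 < x i.+1 by apply: position_gt0.
have [iK2|iK2] := ltnP i.+2 (p + q).
  have := tail_recurrence (i := i.+1) ltac:(lia) iK2; rewrite /= E.
  have : x i.+2 <= x i.+1 by apply: position_mono; rewrite ?rk; lia.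
  have : 0 < (1 - lam) * x i.+1 by rewrite mulr_gt0 // subr_gt0.
  lra.
have e1 : (p + q).-1 = i.+1 by lia.
have := end_equation; rewrite e1 /=.
have b1 : 1 <= (b.+1 - q)%:R :> R by rewrite -[1]/(1%:R) ler_nat; lia.
have : 0 < ((b.+1 - q)%:R - lam) * x i.+1 by rewrite mulr_gt0 // subr_gt0; lra.
rewrite -E; lra.
Qed.

(** The argument of [left_lt_right] for the reflection to [p + 3 - i]. It starts with [x (p + 1)]
    and [x 0], whose equality would contradict the equation at index [p + 1]. *)
Lemma right_lt_left i : (0 < i)%N -> (i.*2 < p.+3)%N -> y (p.+3 - i)%N < y i.
Proof.
have le j : (0 < j)%N -> (j.*2 <= p.+3)%N -> y (p.+3 - j)%N <= y j.
  case: j => [//|j] _ jp; rewrite subSS subSn /=; last lia.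
  apply: position_mono; try lia; rewrite /path_rank.
  case: (ltnP p j); case: (leqP j.*2 p); case: (ltnP p (p.+1 - j));
    case: (leqP (p.+1 - j).*2 p); lia.
case: i => // i _; elim: i => [|i IHi] ip.
  rewrite subSS subn0 /= lt_def; apply/andP; split; last first.
    by have := le 1%N isT ltac:(lia); rewrite subSS subn0.
  apply/eqP => E.
  have xp1 : 0 < x p.+1 by apply: position_gt0; lia.
  have : x p <= x 1.
    by have := le 2 isT ltac:(lia); rewrite !subSS subn0.
  have := bare_recurrence (i := 1) ltac:(lia); rewrite /= add0r => r1.
  have [q2|q2] := ltnP 2 q.
    have := tail_recurrence (i := p.+1) ltac:(lia) ltac:(lia).
    have := tail_lt (i := p.+1) ltac:(lia) ltac:(lia).
    rewrite E in r1 => /=; lra.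
  have e1 : (p + q).-1 = p.+1 by lia.
  have := end_equation; rewrite e1 /=.
  (* With [q = 2] this vertex is the end of the path and carries [b - 1] leaves. *)
  have b2 : 2 <= (b.+1 - q)%:R :> R by rewrite ler_nat; lia.
  have : 0 < ((b.+1 - q)%:R - 1) * x p.+1 by rewrite mulr_gt0 // subr_gt0; lra.
  rewrite E in r1; lra.
rewrite lt_def le ?(ltnW ip) // andbT; apply/eqP => E.
have r1 := bare_recurrence (i := i.+2) ltac:(lia).
have r2 := bare_recurrence (i := p.+3 - i.+2)%N ltac:(lia).
rewrite -E -r1 in r2.
have lt1 : y (p.+3 - i.+1)%N < y i.+1 by apply: IHi; lia.
rewrite [(p.+3 - i.+2).+1](_ : _ = p.+3 - i.+1)%N in r2; last lia.
rewrite [(p.+3 - i.+2).-1](_ : _ = p.+3 - i.+3)%N in r2; last lia.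
have [ip2|ip2] := leqP i.+3.*2 p.+3;
  first by move: (le i.+3 isT ip2) r2 lt1 => /=; lra.
have i2 : (p.+3 - i.+3)%N = i.+2 by lia.
have i2' : (p.+3 - i.+2)%N = i.+3 by lia.
move: r2 E lt1; rewrite i2 i2' /=; lra.
Qed.

End BarePart.

(** Consecutive positive ranks belong to neighbours in the caterpillar part, or to mirror images
    under the two reflections, which alternate. *)
Lemma ranked_values_strict : (if p == 0%N then q < b else 2 < b)%N ->
  forall i, (i < p + q)%N -> a i < a i.+1.
Proof.
move=> pqb i iK.
have xE j k : path_rank p q j = k -> x j = a k by rewrite /x => ->.
case: i iK => [|i] iK.
  rewrite a0 -(xE (p + q).-1 1%N); first by apply: position_gt0; lia.
  rewrite /path_rank; case: (ltnP p (p + q).-1); case: (leqP (p + q).-1.*2 p);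
    lia.
have [p0|p0] := eqVneq p 0%N.
  move: pqb; rewrite p0 eqxx => qb;
    have [_ inc] := caterpillar_increments p0 qb.
  have rk j : path_rank p q j = (q - j)%N.
    by rewrite /path_rank p0; case: (ltnP 0 j); case: (leqP j.*2 0); lia.
  rewrite -(xE (q - i.+1)%N) ?rk; last lia.
  rewrite -(xE (q - i.+2)%N) ?rk; last lia.
  by have := inc (q - i.+2)%N ltac:(lia); rewrite subnSK //; lia.
have {}pqb : (2 < b)%N by move: pqb; rewrite (negPf p0).
have {}p0 : (0 < p)%N by rewrite lt0n.
have [iq|qi] := ltnP i.+2 q.
  have rk j : (p < j)%N -> path_rank p q j = (p + q - j)%N.
    by rewrite /path_rank => ->.
  rewrite -(xE (p + q - i.+1)%N) ?rk; try lia.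
  rewrite -(xE (p + q - i.+2)%N) ?rk; try lia.
  have := tail_lt p0 pqb (i := (p + q - i.+2)%N) ltac:(lia) ltac:(lia).
  by rewrite subnSK //; lia.
have leftR j : (j.*2 <= p)%N -> path_rank p q j = (q + j.*2)%N.
  by move=> jp; rewrite /path_rank jp; case: (ltnP p j); lia.
have rightR j : (j <= p)%N -> (p < j.*2)%N -> path_rank p q j = (q + (p -
  j).*2).+1.
  by rewrite /path_rank; case: (ltnP p j); case: (leqP j.*2 p); lia.
have tailR : path_rank p q p.+1 = q.-1 by rewrite /path_rank ltnSn; lia.
(* The parity decides whether the higher of the two ranks lies on the left side (first case) or on
   the right. *)
have [s] : exists s, (i.+2 = q + s.*2 \/ i.+1 = q + s.*2)%N.
  by exists (i.+2 - q)%N./2; lia.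
case=> iE.
  have := right_lt_left p0 pqb (i := s.+1) ltac:(lia) ltac:(lia).
  rewrite subSS subSn /=; last lia.
  rewrite (xE s i.+2); last by rewrite leftR; lia.
  case: s iE => [|s] iE; first by rewrite subn0 (xE _ i.+1) ?tailR //; lia.
  by rewrite subSS (xE _ i.+1) // rightR; lia.
have := left_lt_right p0 pqb (i := s.+1) ltac:(lia).
rewrite subSS subSn /=; last lia.
rewrite (xE s i.+1); last by rewrite leftR; lia.
by rewrite (xE _ i.+2) // rightR; lia.
Qed.

End StrictMonotonicity.

(** * Comparison *)

(** Sort the interior vertices by value: [r] is the position counted from 1, and index 0 of [a] is
    kept for the leaves. *)
Lemma value_ranking (R : realType) (G : sgraph) (f : G -> R) (k : nat) :
  #|interior_vertices G| = k -> dirichlet_fun f -> (forall x, 0 <= f x) ->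
  exists r a, [/\ ranking k r, a 0%N = 0,
    {in [pred i | i <= k]%N &, {homo a : i j / (i <= j)%N >-> i <= j}} &
    forall x, f x = a (r x)].
Proof.
move=> cardI f0 f_ge0; pose le : rel G := fun x y => f x <= f y.
have le_tr : transitive le by move=> y x z; apply: le_trans.
have le_refl : reflexive le by move=> x; apply: lexx.
pose s := sort le (enum (interior_vertices G)).
have mem_s x : (x \in s) = (x \in interior_vertices G).
  by rewrite mem_sort mem_enum.
have size_s : size s = k by rewrite size_sort -cardE.
have uniq_s : uniq s by rewrite sort_uniq enum_uniq.
have sorted_s : sorted le s by apply: sort_sorted => x y; apply: le_total.
pose r x := if x \in interior_vertices G then (index x s).+1 else 0%N.
exists r, (fun i => if i is i'.+1 then nth 0 (map f s) i' else 0); split=> //.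
- split=> //.
  + by move=> x; rewrite /r in_setC; case: (x \in leaves G).
  + move=> x y xI yI; rewrite /r xI yI => -[E].
    have xs : x \in s by rewrite mem_s.
    by rewrite -(nth_index x xs) E nth_index ?mem_s.
  + by move=> x; rewrite /r; case: ifP => // xI;
    rewrite -size_s index_mem mem_s.
- have sorted_fs : sorted <=%R (map f s) by rewrite sorted_map.
  move=> [|i] [|j] //=; rewrite !inE -size_s -(size_map f) => ik jk ij.
    by have /mapP[x _ ->] := mem_nth 0 jk.
  exact: (sorted_leq_nth le_trans lexx 0 sorted_fs).
- move=> x; rewrite /r; case: ifP => [xI|/negbT]; last first.
    by rewrite in_setC negbK => /f0.
  by rewrite (nth_map x) ?index_mem ?mem_s // nth_index ?mem_s.
Qed.

Section Comparison.
Variables (R : realType) (G : sgraph) (p q b : nat).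
Hypotheses (treeG : is_tree G) (G_gt2 : (2 < #|G|)%N).
Hypotheses (q_ge2 : (2 <= q)%N) (q_le_b : (q <= b)%N).
Hypotheses (cardI : #|interior_vertices G| = (p + q)%N) (cardL : #|leaves G| =
  b).
Hypothesis supports_ge : (q <= #|support_vertices G|)%N.
Let T := path_tree p q b.

Let T_I_neq0 : interior_vertices T != set0.
Proof. by rewrite -card_gt0 card_interior_path_tree //; lia. Qed.

Let G_I_neq0 : interior_vertices G != set0.
Proof. by rewrite -card_gt0 cardI; lia. Qed.

(* Placing the values of a minimizer on [G] on the path tree in the order given
   by [path_rank] preserves the norm and does not increase any cut. *)
Lemma rearranged_minimizer : exists (r : G -> nat) (a : nat -> R),
  let g : T -> R := a \o @vertex_rank p q b in
  [/\ [/\ ranking (p + q) r, a 0%N = 0,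
      {in [pred i | i <= p + q]%N &, {homo a : i j / (i <= j)%N >-> i <= j}} &
      0 < a (p + q)%N],
    dirichlet_fun g, (exists x, g x != 0), rayleigh g <= lambda1 R G &
    lambda1 R G <= rayleigh g ->
    (forall i, (i < p + q)%N -> a i < a i.+1) ->
    forall i j, (i <= j)%N -> (j < p + q)%N ->
      cut r i j = cut (@vertex_rank p q b) i j].
Proof.
have [f [fN0 f0 f_ge0 fE]] := lambda1_nonneg_minimizer R G_I_neq0.
have [r [a [rk a0 a_mono fa]]] := value_ranking cardI f0 f_ge0.
have pk := path_ranking p q_ge2 q_le_b.
exists r, a => g.
have g0 : dirichlet_fun g by move=> x; rewrite /g /= -(rank_eq0 pk) => /eqP ->.
have norm_eq : \sum_(x in interior_vertices T) g x ^+ 2 =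
    \sum_(x in interior_vertices G) f x ^+ 2.
  rewrite (sum_interior_rank (fun i => a i ^+ 2) pk).
  by rewrite -(sum_interior_rank (fun i => a i ^+ 2) rk);
    apply: eq_bigr => x _; rewrite fa.
have norm_gt0 := sum_interior_gt0 fN0 f0.
have a_top : 0 < a (p + q)%N.
  have ge0 : 0 <= a (p + q)%N by rewrite -a0; apply: a_mono; rewrite ?inE.
  rewrite lt_def ge0 andbT; apply/eqP => atop; case: fN0 => x; rewrite fa.
  have rx := rank_le rk x; have := a_mono (r x) (p + q)%N rx (leqnn _) rx.
  have := a_mono 0%N (r x) (leq0n _) rx (leq0n _).
  by rewrite a0 atop => ge le /eqP; apply; lra.
have gN0 : exists x, g x != 0.
  case: (pickP (fun x : T => g x != 0)) => [x gx|gz]; first by exists x.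
  move: norm_gt0; rewrite -norm_eq big1 ?ltxx // => x _.
  by move/negbFE/eqP: (gz x) => ->; rewrite expr0n.
(* The Rayleigh numerator of [a \o s] on [H]. *)
pose C (H : sgraph) (s : H -> nat) : R := \sum_(i < p + q) \sum_(j < p + q)
  (cut s (minn i j) (maxn i j))%:R * ((a i.+1 - a i) * (a j.+1 - a j)).
have rayG : lambda1 R G = C G r / \sum_(x in interior_vertices G) f x ^+ 2.
  rewrite -fE /rayleigh; congr (_ / _).
  under eq_bigr => x _ do under eq_bigr => y _ do rewrite !fa.
  by rewrite (energy_cut (k := (p + q)%N)) ?mulKf ?pnatr_eq0 //;
    apply: rank_le rk.
have rayT : rayleigh g = C T (@vertex_rank p q b) / \sum_(x in
  interior_vertices G) f x ^+ 2.
  rewrite /rayleigh norm_eq; congr (_ / _).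
  by rewrite (energy_cut (k := (p + q)%N)) ?mulKf ?pnatr_eq0 //;
    apply: rank_le pk.
have cut_le i j : (i <= j)%N -> (j < p + q)%N ->
    (cut (@vertex_rank p q b) i j <= cut r i j)%N.
  move=> ij jk; apply: leq_trans (path_tree_cut_le q_ge2 q_le_b ij jk) _.
  exact: min_cut_le rk treeG G_gt2 _ _ _ _ cardL supports_ge ij jk.
have inc_ge0 (i : 'I_(p + q)) : 0 <= a i.+1 - a i.
  by rewrite subr_ge0; apply: a_mono; rewrite ?inE //; have := ltn_ord i; lia.
have term_le (i j : 'I_(p + q)) :
    (cut (@vertex_rank p q b) (minn i j) (maxn i j))%:R * ((a i.+1 - a i) * (a
      j.+1 - a j))
    <= (cut r (minn i j) (maxn i j))%:R * ((a i.+1 - a i) * (a j.+1 - a j)).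
  rewrite ler_wpM2r ?mulr_ge0 // ler_nat cut_le //; have := ltn_ord i;
    have := ltn_ord j; lia.
split=> //.
  rewrite rayG rayT ler_wpM2r ?invr_ge0 ?(ltW norm_gt0) //.
  by apply: ler_sum => i _; apply: ler_sum.
rewrite rayG rayT ler_pM2r ?invr_gt0 // => CG_le a_lt i j ij jk.
(* These weighted differences of cuts are nonnegative with sum 0, so each is 0; the weights are
   positive. *)
pose D (i j : 'I_(p + q)) : R := ((cut r (minn i j) (maxn i j))%:R -
  (cut (@vertex_rank p q b) (minn i j) (maxn i j))%:R) *
  ((a i.+1 - a i) * (a j.+1 - a j)).
have D_ge0 i' j' : 0 <= D i' j' by rewrite /D mulrBl subr_ge0 term_le.
have DE : \sum_i' \sum_j' D i' j' = 0.
  transitivity (C G r - C T (@vertex_rank p q b)).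
    rewrite /C -sumrB; apply: eq_bigr => i' _; rewrite -sumrB.
    by apply: eq_bigr => j' _; rewrite /D mulrBl.
  apply/eqP; rewrite subr_eq0 eq_le CG_le.
  by apply: ler_sum => i' _; apply: ler_sum.
have ik := leq_ltn_trans ij jk.
have row0 : \sum_j' D (Ordinal ik) j' = 0.
  by apply: (psumr_eq0P _ DE) => // i' _; apply: sumr_ge0.
have /eqP : D (Ordinal ik) (Ordinal jk) = 0 by apply: (psumr_eq0P _ row0).
rewrite /D /=.
have inc_neq0 l : (l < p + q)%N -> (a l.+1 - a l == 0) = false.
  by move=> lk; rewrite subr_eq0 gt_eqF // a_lt.
rewrite (minn_idPl ij) (maxn_idPr ij) mulf_eq0 mulf_eq0 !inc_neq0 // !orbF.
by rewrite subr_eq0 eqr_nat => /eqP.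
Qed.

Lemma lambda1_path_tree_le : lambda1 R T <= lambda1 R G.
Proof.
have [r [a [_ g0 gN0 g_le _]]] := rearranged_minimizer.
by apply: le_trans g_le; have [_ _ _] := lambda1P R T_I_neq0; apply.
Qed.

Lemma lambda1_path_tree_rigid : (if p == 0%N then q < b else 2 < b)%N ->
  lambda1 R G <= lambda1 R T -> isomorphic G T.
Proof.
move=> pqb le_lam;
  have [r [a [[rk a0 a_mono a_top] g0 gN0 g_le cutE]]] := rearranged_minimizer.
have pk := path_ranking p q_ge2 q_le_b.
have [_ _ _ lamT_le] := lambda1P R T_I_neq0.
apply: (cut_isomorphic treeG G_gt2 rk (path_tree_is_tree _ _ _) (path_tree_gt2
  _ _ _) pk) => //.
apply: cutE; first exact: le_trans le_lam (lamT_le _ gN0 g0).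
have eigen := minimizer_eigen T_I_neq0 gN0 g0 (le_trans g_le le_lam).
apply: (ranked_values_strict (lam := lambda1 R T) q_ge2 q_le_b) => // i iK.
have := eigen (inl (Ordinal iK) : T);
  rewrite in_setC leaves_path_tree // => /(_ isT).
by rewrite (path_tree_laplacian q_ge2 q_le_b (x := a \o path_rank p q)).
Qed.

End Comparison.

(** * Isomorphic trees and trees with two leaves *)

Lemma isomorphic_lambda1 (R : realType) (G H : sgraph) :
  isomorphic G H -> interior_vertices H != set0 -> lambda1 R G <= lambda1 R H.
Proof.
move=> [h bij_h hadj] HI; case: (bij_h) => h' hK h'K.
have deg x : degree (h x) = degree x.
  rewrite /degree -(card_imset _ (bij_inj bij_h)); apply: eq_card => y.
  rewrite !inE; apply/idP/imsetP => [ay|[z + ->]]; last by rewrite inE hadj.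
  by exists (h' y); rewrite ?h'K // inE -hadj h'K.
have hL x : (h x \in leaves H) = (x \in leaves G) by rewrite !inE deg.
have [[g [[y gy] g0 gE]] _ _ _] := lambda1P R HI.
have GI : interior_vertices G != set0.
  case/set0Pn: HI => z zI; apply/set0Pn; exists (h' z).
  by rewrite in_setC -hL h'K -in_setC.
have [_ + _ _] := lambda1P R GI; apply.
exists (g \o h); split.
- by exists (h' y); rewrite /= h'K.
- by move=> x xL; apply: g0; rewrite hL.
move=> x; rewrite in_setC -hL -in_setC => /gE /= <-; congr (- _).
rewrite /laplacian [RHS](reindex h) /=; last exact: onW_bij.
by apply: eq_bigl => z; rewrite hadj.
Qed.

Lemma isomorphic_sym (G H : sgraph) : isomorphic G H -> isomorphic H G.
Proof.
move=> [h [h' hK h'K] hadj]; exists h'; first by exists h.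
by move=> x y; rewrite -hadj !h'K.
Qed.

(* Rooted at one of its two leaves, the tree is a single descending path:
   the map sending every vertex to its lower neighbour, and the other leaf back
   to the root, is a cyclic permutation of the vertices. *)
Lemma two_leaves_isomorphic (G : sgraph) (p : nat) : is_tree G ->
  #|leaves G| = 2%N -> #|interior_vertices G| = (p + 2)%N ->
  isomorphic G (path_tree p 2 2).
Proof.
move=> treeG cardL cardI; have [_ _ acyc] := treeG.
have cardG : #|G| = (p + 4)%N by rewrite -card_interior cardL cardI; lia.
have G_gt2 : (2 < #|G|)%N by lia.
have /cards2P [r [l [rl LE]]] : #|leaves G| == 2%N by rewrite cardL.
have [o oP] := acyclic_order r acyc.
have ex x : exists y, (x != l) ==> (adj x y && (o y < o x)%N).
  have [|] := boolP (x == l); first by exists x.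
  move=> xl; have [|y axy oyx] := order_lower oP (x := x); last by exists y;
    rewrite axy.
  have [->|xr] := eqVneq x r; first exact: degree_gt0.
  by rewrite -interior_degree // in_setC LE !inE negb_or xr.
have [c0 c0P] := fin_all_exists ex.
pose c x := if x == l then r else c0 x.
have cP x : x != l -> adj x (c x) /\ (o (c x) < o x)%N.
  by rewrite /c => xl; have := c0P x; rewrite xl (negPf xl) => /andP.
have c_upper x y : x != l -> adj (c x) y -> (o (c x) <= o y)%N -> y = x.
  move=> xl axy oxy; have [axc ocx] := cP x xl.
  by apply: (order_upper_uniq oP axy _ oxy (ltnW ocx)); rewrite adj_sym.
have c_root x : x != l -> c x != r.
  move=> xl; apply/eqP => E; have [axc ocx] := cP x xl.
  by have := @order_root _ _ _ oP x; rewrite -E adj_sym => /(_ axc); lia.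
have c_inj : injective c.
  move=> x y; have [->|xl] := eqVneq x l; have [->|yl] := eqVneq y l => //.
  - by rewrite {1}/c eqxx => /esym/eqP; rewrite (negPf (c_root _ yl)).
  - by rewrite [c l]/c eqxx => /eqP; rewrite (negPf (c_root _ xl)).
  move=> E; have [ayc oyc] := cP y yl; apply/esym/(c_upper x) => //.
    by rewrite E adj_sym.
  by rewrite E ltnW.
(* Going up from [z] along the inverse of [c] raises [o] until [r] is reached. *)
have conn z : fconnect c r z.
  have [N] := ubnP (\max_x o x - o z); elim: N z => // N IHN z oN.
  have [->|zr] := eqVneq z r; first exact: connect0.
  have zc : c (finv c z) = z by apply: f_finv.
  have zl : finv c z != l.
    by apply: contraNneq zr => E; rewrite -zc E /c eqxx.
  have [_] := cP _ zl; rewrite zc => oz.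
  have le : (o (finv c z) <= \max_x o x)%N by apply: leq_bigmax.
  by rewrite -zc; apply: connect_trans (IHN _ _) (fconnect1 _ _); lia.
have orderE : order c r = #|G|.
  by apply: eq_card => z; rewrite !inE /= conn.
(* [c l = r] closes the cycle, so [l] is the last vertex reached from [r]. *)
have lE : iter (p + 3) c r = l.
  apply: (c_inj); rewrite -iterS [c l]/c eqxx.
  have -> : (p + 3).+1 = order c r by rewrite orderE cardG; lia.
  exact: iter_order.
have iter_inj i j : (i < p + 4)%N -> (j < p + 4)%N -> iter i c r = iter j c r
  -> i = j.
  rewrite -cardG -orderE => ik jk E.
  by rewrite -(findex_iter ik) E findex_iter.
have iter_l i : (i < p + 3)%N -> iter i c r != l.
  by move=> ik; apply/eqP; rewrite -lE => /iter_inj; lia.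
have adjE i j : (i < p + 4)%N -> (j < p + 4)%N ->
    adj (iter i c r) (iter j c r) = (j == i.+1) || (i == j.+1).
  wlog oij : i j / (o (iter j c r) <= o (iter i c r))%N.
    move=> W ik jk;
      have [/W|/ltnW/W] := leqP (o (iter j c r)) (o (iter i c r)); first exact.
    by rewrite adj_sym orbC; apply.
  move=> ik jk; apply/idP/orP => [aij|[/eqP jE|/eqP iE]].
  - have [z zE] : exists z, c z = iter j c r by exists (finv c (iter j c r));
    apply: f_finv.
    have zl : z != l.
      apply: contraTneq aij => zl; move: zE oij;
        rewrite zl {1}/c eqxx => <- oij.
      by apply/negP; rewrite adj_sym => /(order_root oP); lia.
    have xz : iter i c r = z by apply: c_upper; rewrite ?zE // adj_sym.
    have il : i != (p + 3)%N by apply: contraNneq zl => iE; rewrite -xz iE lE.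
    left; apply/eqP/iter_inj; [lia|lia|].
    by rewrite iterS xz zE.
  - by rewrite jE iterS; case: (cP (iter i c r)) => //; apply: iter_l; lia.
  - by rewrite iE iterS adj_sym; case: (cP (iter j c r)) => //; apply: iter_l;
    lia.
pose w (u : path_tree p 2 2) : nat :=
  match u with inl i => i.+1 | inr k => if val k == 0%N then 0%N else (p +
    3)%N end.
have w_lt u : (w u < p + 4)%N.
  by case: u => [i|k] /=; [have := ltn_ord i|case: ifP]; lia.
have w_inj : injective w.
  move=> [i|k] [j|l'] /=.
  - by move=> [/val_inj->].
  - by have := ltn_ord i; case: ifP; lia.
  - by have := ltn_ord j; case: ifP; lia.
  - have := ltn_ord k; have := ltn_ord l'; case: eqP => k0; case: eqP => l0;
    try lia.
    by move=> _ _ _; congr inr; apply: val_inj; rewrite /= k0 l0.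
    by move=> *; congr inr; apply: val_inj => /=; move: k0 l0 => /=; lia.
have w_adj u v : adj u v = (w v == (w u).+1) || (w u == (w v).+1).
  rewrite /adj /=; case: u v => [i|k] [j|l'] /=; rewrite ?eqSS //.
  - have := ltn_ord i; have := ltn_ord l'; rewrite /pendant_at.
    by case: (eqVneq (l' : nat) 0%N) => ? /=; [|case: (ltnP l' 1) => ?]; lia.
  - have := ltn_ord j; have := ltn_ord k; rewrite /pendant_at.
    by case: (eqVneq (k : nat) 0%N) => ? /=; [|case: (ltnP k 1) => ?]; lia.
  - by case: (eqVneq (k : nat) 0%N) => ?;
    case: (eqVneq (l' : nat) 0%N) => ? /=; lia.
apply: isomorphic_sym; exists (fun u => iter (w u) c r); last first.
  by move=> u v; rewrite adjE // -w_adj.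
apply: inj_card_bij => [u v /iter_inj E|]; first by apply: w_inj; apply: E.
by rewrite card_path_tree // cardG; lia.
Qed.

(** * Support vertices and trees with first eigenvalue 1 *)

Section Supports.
Variable G : sgraph.
Hypotheses (treeG : is_tree G) (G_gt2 : (2 < #|G|)%N).
Implicit Types x y : G.

Lemma support_leaf_injection : exists h : G -> G,
  (forall x, x \in support_vertices G -> h x \in leaves G /\ adj x (h x)) /\
  {in support_vertices G &, injective h}.
Proof.
have ex x : exists y, (x \in support_vertices G) ==> (y \in leaves G) && adj x
  y.
  have [|_] := boolP (x \in _); last by exists x.
  by rewrite inE => /existsP.
have [h hP] := fin_all_exists ex.
have {}hP x : x \in support_vertices G -> h x \in leaves G /\ adj x (h x).
  by move=> xA; have := hP x; rewrite xA => /andP.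
exists h; split=> // x y /hP[hxL axh] /hP[_ ayh] E.
have [z _ zP] := leaf_neighbour hxL.
by rewrite (zP x) 1?adj_sym // (zP y) // E adj_sym.
Qed.

Lemma card_supports_le : (#|support_vertices G| <= #|leaves G|)%N.
Proof.
have [h [hP h_inj]] := support_leaf_injection.
rewrite -(card_in_imset h_inj); apply: subset_leq_card.
by apply/subsetP => _ /imsetP[x /hP[xL _] ->].
Qed.

Lemma supports_interior : support_vertices G \subset interior_vertices G.
Proof.
apply/subsetP => x; rewrite inE => /existsP[y /andP[yL axy]].
by apply: (leaf_adj_interior treeG G_gt2 yL); rewrite adj_sym.
Qed.

(** An exit of the whole interior ends in a leaf, which gives a support vertex [u]. The interior
    without [u] has an exit that does not end in [u], hence again ends in a leaf. *)
Lemma supports_gt1 : (1 < #|interior_vertices G|)%N -> (1 < #|support_vertices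
  G|)%N.
Proof.
move=> I_gt1; have [_ _ acyc] := treeG.
have exit (U : {set G}) v : U != set0 -> {subset U <= interior_vertices G} ->
    interior_vertices G \subset v |: U -> exists2 u, u \in U & u \in
      support_vertices G.
  move=> U0 UI IU; have [|u [y [uU yU yv auy]]] := two_exits v acyc U0.
    by move=> u /UI; rewrite interior_degree.
  exists u => //; rewrite inE; apply/existsP; exists y; rewrite auy andbT.
  apply: contraNT yU => yL;
    have /(subsetP IU) : y \in interior_vertices G by rewrite in_setC.
  by rewrite in_setU1 (negPf yv).
have /card_gt0P[x xI] : (0 < #|interior_vertices G|)%N by lia.
have [|//||u uI uA] := exit (interior_vertices G) x.
- by apply/set0Pn; exists x.
- exact: subsetUr.
have [|||v] := exit (interior_vertices G :\ u) u.
- by rewrite -card_gt0; move: I_gt1; rewrite (cardsD1 u) uI.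
- by move=> v; rewrite in_setD1 => /andP[].
- by apply/subsetP => v; rewrite in_setU1 in_setD1; case: eqP.
rewrite in_setD1 => /andP[vu _] vA; apply/card_gt1P; exists u, v.
by rewrite eq_sym.
Qed.

(** By counting, every interior vertex is a support vertex, and the leaves chosen for them are all
    the leaves. *)
Lemma unique_leaf_neighbour :
  #|support_vertices G| = #|interior_vertices G| ->
  #|leaves G| = #|interior_vertices G| ->
  forall x, x \in interior_vertices G -> #|[set y in leaves G | adj x y]| = 1%N.
Proof.
move=> cardA cardL x xI; have [h [hP h_inj]] := support_leaf_injection.
have AI : support_vertices G = interior_vertices G.
  by apply/eqP; rewrite eqEcard supports_interior cardA leqnn.
rewrite AI in hP h_inj.
have imL : h @: interior_vertices G = leaves G.
  apply/eqP; rewrite eqEcard card_in_imset // cardL leqnn andbT.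
  by apply/subsetP => _ /imsetP[y /hP[yL _] ->].
apply/eqP/cards1P; exists (h x); apply/setP => y; rewrite in_set1 in_set.
apply/andP/eqP => [[yL axy]|->]; last exact: hP.
have [z _ zP] := leaf_neighbour yL.
move: (yL); rewrite -imL => /imsetP[x' x'I yE].
rewrite yE (zP x) 1?adj_sym // (zP x') // yE adj_sym; by case: (hP _ x'I).
Qed.

Variable R : realType.

(** The indicator of the interior is an eigenfunction with eigenvalue 1. *)
Lemma lambda1_le1 : interior_vertices G != set0 ->
  (forall x, x \in interior_vertices G -> #|[set y in leaves G | adj x y]| =
    1%N) ->
  lambda1 R G <= 1.
Proof.
move=> I0 one; have [_ + _ _] := lambda1P R I0; apply.
exists (fun x => (x \in interior_vertices G)%:R); split.
- by case/set0Pn: I0 => x xI; exists x; rewrite xI oner_eq0.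
- by move=> x xL; rewrite in_setC xL.
move=> x xI; rewrite /laplacian xI mulr1 -sumrN.
rewrite -[RHS]/(1%:R) -(one x xI) -sum1_card natr_sum big_mkcond
  [RHS]big_mkcond /=.
apply: eq_bigr => y _; rewrite in_set in_setC.
by case: (adj x y); case: (y \in leaves G);
  rewrite /= ?subrr ?oppr0 ?sub0r ?opprK.
Qed.

(* Evaluate the eigenvalue equation where the eigenfunction is maximal. *)
Lemma lambda1_ge1 : interior_vertices G != set0 ->
  support_vertices G = interior_vertices G -> 1 <= lambda1 R G.
Proof.
move=> I0 AI; have [f [fN0 f0 f_ge0 fE]] := lambda1_nonneg_minimizer R I0.
have f_le : rayleigh f <= lambda1 R G by rewrite fE.
have eigen := minimizer_eigen I0 fN0 f0 f_le.
case: fN0 => x0 fx0.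
case: (@Order.TotalTheory.arg_maxP _ _ G x0 xpredT f) => // x _ xmax.
have fx : 0 < f x.
  by apply: lt_le_trans (xmax x0 isT); rewrite lt_def fx0 f_ge0.
have xI : x \in interior_vertices G.
  by rewrite in_setC; apply: contraTN fx => /f0 ->; rewrite ltxx.
have : x \in support_vertices G by rewrite AI.
rewrite inE => /existsP[y /andP[yL axy]].
rewrite -(ler_pM2r fx) mul1r -eigen // /laplacian -sumrN (bigD1 y) //=.
rewrite (f0 y yL) sub0r opprK lerDl; apply: sumr_ge0 => z _.
by rewrite opprB subr_ge0; exact: xmax.
Qed.

End Supports.

(** * Trees with given order, matching number and number of leaves *)

Lemma tree_class_interior n m b (G : sgraph) : tree_class n m b G ->
  (#|interior_vertices G| + b = n)%N.
Proof. by move=> [_ <- _ <-]; apply: card_interior. Qed.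

Lemma tree_class_supports n m b (G : sgraph) : tree_class n m b G ->
  (2 * m + b - n <= #|support_vertices G|)%N.
Proof. by move=> [_ <- <- <-]; have := matching_number_supports G; lia. Qed.

(** With [n - b] interior vertices, the lower bound is [matching_number_half], the bound by [m] is
    [matching_number_interior], and the bound by [b] holds because distinct support vertices have
    distinct leaves. *)
Lemma tree_class_bounds n m b (G : sgraph) : (3 <= n)%N -> (2 <= b)%N ->
  tree_class n m b G -> (1 <= 2 * m + b - n <= minn b m)%N.
Proof.
move=> n3 b2 GC; have := tree_class_supports GC; have := tree_class_interior GC.
case: GC => treeG nE mE bE; rewrite -nE in n3.
have := card_supports_le G; have := matching_number_interior treeG n3.
have [r rL] : exists r, r \in leaves G by apply/card_gt0P; lia.
by have := matching_number_half treeG n3 rL; lia.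
Qed.

(** Serves all cases with a path tree as minimizer; the condition for [p = 0] excludes [q = b],
    where [lambda1] is constant on the class. *)
Lemma faber_krahn_path_tree (R : realType) n m b p q :
  (2 <= q <= b)%N -> n = (p + q + b)%N -> m = (q + p./2)%N ->
  (p = 0 -> q < b)%N ->
  (forall G, tree_class n m b G -> q <= #|support_vertices G|)%N ->
  forall G, faber_krahn R (tree_class n m b) G <->
    tree_class n m b G /\ isomorphic G (path_tree p q b).
Proof.
move=> /andP[q2 qb] nE mE p0 suppq G.
have TC := path_tree_class q2 qb nE mE.
have TI : interior_vertices (path_tree p q b) != set0.
  by rewrite -card_gt0 card_interior_path_tree //; lia.
have gt2 H : tree_class n m b H -> (2 < #|H|)%N by case=> _ -> _ _; lia.
have cardI H : tree_class n m b H -> #|interior_vertices H| = (p + q)%N.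
  by move/tree_class_interior; lia.
have T_le H : tree_class n m b H -> lambda1 R (path_tree p q b) <= lambda1 R H.
  move=> HC; have [treeH _ _ bH] := HC.
  exact: lambda1_path_tree_le treeH (gt2 _ HC) q2 qb (cardI _ HC) bH (suppq _
    HC).
split=> -[GC]; last first.
  by move=> iso; split=> // H /T_le; apply: le_trans; apply: isomorphic_lambda1.
have [treeG _ _ bG] := GC; move=> /(_ _ TC) le_lam; split=> //.
(* With two leaves the tree is a path, and the isomorphism is built directly instead of from the
   cuts. *)
have [/andP[/eqP b2 p_gt0]|nb] := boolP ((b == 2) && (0 < p))%N.
  have q2E : q = 2 by lia.
  by have := cardI _ GC; rewrite b2 q2E in bG *; apply: two_leaves_isomorphic.
have pqb : (if p == 0 then q < b else 2 < b)%N by case: eqP => [/p0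
  //|p_neq0]; lia.
exact: lambda1_path_tree_rigid (gt2 _ GC) q2 qb (cardI _ GC) bG (suppq _ GC)
  pqb le_lam.
Qed.

Theorem theorem1p5 (R : realType) (m n b : nat)
    (m_ge2 : (2 <= m)%N) (n_ge3 : (3 <= n)%N) (b_ge2 : (2 <= b)%N) :
  let t := (2 * m + b - n)%N in
  (forall T : sgraph, tree_class n m b T -> (1 <= t <= minn b m)%N) /\
  (forall T : sgraph,
    faber_krahn R (tree_class n m b) T <->
    tree_class n m b T /\
    ((t = 1%N /\ isomorphic T (path_tree (2 * m - 3)%N 2 b)) \/
     ((2 <= t)%N /\
      [/\ (t < m)%N -> isomorphic T (path_tree (2 * m - 2 * t)%N t b),
          t = m /\ m = b ->
            forall x, x \in interior_vertices T ->
              #|[set y in leaves T | adj x y]| = 1%N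
        & t = m /\ (m < b)%N -> isomorphic T (path_tree 0 t b)]))).
Proof.
move=> t; have bounds T := @tree_class_bounds n m b T n_ge3 b_ge2.
split=> // T.
(* Both sides place [T] in the class, so a member [G] may be assumed, which makes the bounds on [t]
   available. *)
suff {T} fk : forall G, tree_class n m b G -> forall T,
    faber_krahn R (tree_class n m b) T <-> tree_class n m b T /\
    ((t = 1%N /\ isomorphic T (path_tree (2 * m - 3)%N 2 b)) \/
     ((2 <= t)%N /\
      [/\ (t < m)%N -> isomorphic T (path_tree (2 * m - 2 * t)%N t b),
          t = m /\ m = b ->
            forall x, x \in interior_vertices T ->
              #|[set y in leaves T | adj x y]| = 1%N
        & t = m /\ (m < b)%N -> isomorphic T (path_tree 0 t b)])).
  by split=> [[TC Tmin]|[TC Tcase]]; apply/(fk _ TC).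
move=> G GC T; have := bounds _ GC; rewrite -/t => tb.
have [t1|t_ne1] := eqVneq t 1%N.
  (* Here [q = 2] exceeds [t], because two interior vertices already force two support vertices;
     [p + q] is the number [2 * m - 1] of interior vertices. *)
  rewrite (@faber_krahn_path_tree R n m b (2 * m - 3) 2); try lia; last first.
    move=> H HC; apply: supports_gt1; first by case: HC.
      by case: HC => _ ->.
    by have := tree_class_interior HC; lia.
  split=> -[TC iso]; split=> //; first by left.
  by case: iso => [[_ //]|[t_ge2 _]]; lia.
have [tm|tm] := ltnP t m.
  rewrite (@faber_krahn_path_tree R n m b (2 * m - 2 * t) t); try lia;
    last first.
    exact: tree_class_supports.
  split=> -[TC iso]; split=> //; first by right; split; [lia|split=> //; lia].
  by case: iso => [[tE _]|[_ [iso _ _]]]; [lia|exact: iso].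
have {}tm : t = m by lia.
have [mb|mb] := ltnP m b.
  rewrite (@faber_krahn_path_tree R n m b 0 t); try lia; last first.
    exact: tree_class_supports.
  split=> -[TC iso]; split=> //; first by right; split; [lia|split=> //; lia].
  by case: iso => [[tE _]|[_ [_ _ iso]]]; [lia|exact: iso].
have {}mb : m = b by lia.
(* There are now [m] interior vertices, [m] leaves and at least [m] support vertices, so each
   interior vertex has exactly one leaf. *)
have classP H : tree_class n m b H -> [/\ (2 < #|H|)%N, interior_vertices H !=
  set0,
    support_vertices H = interior_vertices H &
    forall x, x \in interior_vertices H -> #|[set y in leaves H | adj x y]| =
      1%N].
  move=> HC; have := tree_class_supports HC; have HI := tree_class_interior HC.
  case: HC => treeH nE _ bE; rewrite -/t => tA.
  have H2 : (2 < #|H|)%N by rewrite nE.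
  have subAI := supports_interior treeH H2.
  have cardAI := subset_leq_card subAI.
  split=> //; first by rewrite -card_gt0; lia.
    by apply/eqP; rewrite eqEcard subAI /=; lia.
  by apply: unique_leaf_neighbour => //; lia.
split=> [[TC _]|[TC _]]; split=> //.
  by right; split; [lia|split=> [|_|[]]; [lia| |lia]]; case: (classP _ TC).
move=> H HC; have [T2 TI _ one] := classP _ TC;
  have [H2 HI HA _] := classP _ HC.
exact: le_trans (lambda1_le1 R TI one) (lambda1_ge1 R HI HA).
Qed.
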